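(* In the setting above, the $\mathcal A$-algebra homomorphism $\phi_v:H_{S/e}\to H_S$ defined by $\phi_v(T'_s)=T_s$ for $s\in S/e\setminus\{s_0\}$ and $\phi_v(T'_{s_0})=T_{s_+}T_{s_-}T_{s_+}^{-1}$ is injective.
   Context: $\mathcal A=\mathbb Z[v,v^{-1}]$. A Coxeter matrix on $S$ is a symmetric matrix $M=(m_{s,s'})$ with entries in $\mathbb Z_{\ge1}\sqcup\{\infty\}$, $m_{s,s'}=1$ iff $s=s'$; $W_{S,M}$ is the associated Coxeter group. A weight function is a map $L_S:S\to\mathbb Z$ with $L_S(s)=L_S(s')$ whenever $s,s'$ are conjugate in $W_{S,M}$; put $v_s=v^{L_S(s)}$. The Hecke algebra $H_S$ is the associative unital $\mathcal A$-algebra generated by $T_s$ ($s\in S$) with relations $(T_s-v_s)(T_s+v_s^{-1})=0$ for all $s$, and $T_sT_{s'}T_s\cdots=T_{s'}T_sT_{s'}\cdots$ (both sides with $m_{s,s'}$ factors) for all $s\ne s'$ with $m_{s,s'}\ne\infty$. Edge contraction: $e=\{s_+,s_-\}\subseteq S$ with $m_{s_+,s_-}=3$; $S/e=(S\setminus\{s_+,s_-\})\sqcup\{s_0\}$; $N=(n_{s,s'})$ with $n_{s,s}=1$, $n_{s,s'}=m_{s,s'}$ for distinct $s,s'\ne s_0$, and for $s\neq s_0$: $n_{s,s_0}=n_{s_0,s}=m_{s,s_+}+m_{s,s_-}-2$ if $m_{s,s_+}=2$ or $m_{s,s_-}=2$ (with $\infty+k=\infty$), and $=\infty$ if both are $>2$.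 The induced weight function is $L_{S/e}(s_0)=L_S(s_+)$ and $L_{S/e}(s)=L_S(s)$ for $s\ne s_0$. $H_{S/e}$ is the Hecke algebra of $(S/e,N,L_{S/e})$, with generators denoted $T'_s$. It is known that $\phi_v$ is a well-defined algebra homomorphism. *)

(* Defs.v *)
From HB Require Import structures.
From mathcomp Require Import all_boot all_algebra.
Set Implicit Arguments. Unset Strict Implicit. Unset Printing Implicit Defensive.

(* An entry [Some m] is the integer m >= 1, [None] is infinity. *)
Definition coxmat (S : Type) := S -> S -> option nat.

Definition is_coxeter_matrix (S : eqType) (M : coxmat S) : Prop :=
  (forall s s', M s s' = M s' s) /\
  (forall s s', M s s' = Some 1%N <-> s = s') /\
  (forall s s', M s s' <> Some 0%N).

Definition alt_word (S : Type) (s s' : S) (m : nat) : seq S :=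
  mkseq (fun i => if odd i then s' else s) m.

(* Equality in the Coxeter group W_{S,M}, on words in the generators:
   the congruence on the free monoid generated by s^2 = 1 and the braid
   relations (generators are involutions, so this is the group). *)
Inductive cox_eq (S : eqType) (M : coxmat S) : seq S -> seq S -> Prop :=
| cox_refl w : cox_eq M w w
| cox_sym w1 w2 : cox_eq M w1 w2 -> cox_eq M w2 w1
| cox_trans w1 w2 w3 : cox_eq M w1 w2 -> cox_eq M w2 w3 -> cox_eq M w1 w3
| cox_cat u1 u2 w1 w2 : cox_eq M u1 u2 -> cox_eq M w1 w2 ->
    cox_eq M (u1 ++ w1) (u2 ++ w2)
| cox_sq s : cox_eq M [:: s; s] [::]
| cox_braid s s' m : s != s' -> M s s' = Some m ->
    cox_eq M (alt_word s s' m) (alt_word s' s m).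

(* s and s' are conjugate in W_{S,M}: w s w^{-1} = s' (w^{-1} = rev w) *)
Definition cox_conjugate (S : eqType) (M : coxmat S) (s s' : S) : Prop :=
  exists w : seq S, cox_eq M (w ++ s :: rev w) [:: s'].

Definition is_weight (S : eqType) (M : coxmat S) (L : S -> int) : Prop :=
  forall s s', cox_conjugate M s s' -> L s = L s'.

(* Formal terms of the free algebra over A = Z[v,v^-1] on generators T_s:
   TV, TVi stand for v and v^-1 in A. *)
Inductive term (S : Type) : Type :=
| T0 | T1 | TV | TVi
| TGen of S
| TAdd of term S & term S
| TOpp of term S
| TMul of term S & term S.
Arguments T0 {S}. Arguments T1 {S}. Arguments TV {S}. Arguments TVi {S}.

(* Smallest congruence containing R and making the quotient an associative
   unital ring in which v is central with inverse v^-1, i.e. an associative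
   unital A-algebra with A = Z[v,v^-1]. *)
Inductive alg_eq (S : Type) (R : term S -> term S -> Prop) :
    term S -> term S -> Prop :=
| ae_rel x y : R x y -> alg_eq R x y
| ae_refl x : alg_eq R x x
| ae_sym x y : alg_eq R x y -> alg_eq R y x
| ae_trans x y z : alg_eq R x y -> alg_eq R y z -> alg_eq R x z
| ae_add x x' y y' : alg_eq R x x' -> alg_eq R y y' ->
    alg_eq R (TAdd x y) (TAdd x' y')
| ae_opp x x' : alg_eq R x x' -> alg_eq R (TOpp x) (TOpp x')
| ae_mul x x' y y' : alg_eq R x x' -> alg_eq R y y' ->
    alg_eq R (TMul x y) (TMul x' y')
| ae_addA x y z : alg_eq R (TAdd x (TAdd y z)) (TAdd (TAdd x y) z)
| ae_addC x y : alg_eq R (TAdd x y) (TAdd y x)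
| ae_add0 x : alg_eq R (TAdd T0 x) x
| ae_addN x : alg_eq R (TAdd x (TOpp x)) T0
| ae_mulA x y z : alg_eq R (TMul x (TMul y z)) (TMul (TMul x y) z)
| ae_mul1l x : alg_eq R (TMul T1 x) x
| ae_mul1r x : alg_eq R (TMul x T1) x
| ae_mulDl x y z : alg_eq R (TMul (TAdd x y) z) (TAdd (TMul x z) (TMul y z))
| ae_mulDr x y z : alg_eq R (TMul x (TAdd y z)) (TAdd (TMul x y) (TMul x z))
| ae_VVi : alg_eq R (TMul TV TVi) T1
| ae_ViV : alg_eq R (TMul TVi TV) T1
| ae_Vcentral x : alg_eq R (TMul TV x) (TMul x TV).

Definition TSub (S : Type) (x y : term S) := TAdd x (TOpp y).

Definition vpow (S : Type) (k : int) : term S :=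
  match k with
  | Posz n => iter n (TMul TV) T1
  | Negz n => iter n.+1 (TMul TVi) T1
  end.

Definition tprod (S : Type) (l : seq (term S)) : term S := foldr (@TMul S) T1 l.

Inductive hecke_rel (S : eqType) (M : coxmat S) (L : S -> int) :
    term S -> term S -> Prop :=
| hr_quad s : hecke_rel M L
    (TMul (TSub (TGen s) (vpow S (L s))) (TAdd (TGen s) (vpow S (- L s)))) T0
| hr_braid s s' m : s != s' -> M s s' = Some m ->
    hecke_rel M L (tprod (map (@TGen S) (alt_word s s' m)))
                  (tprod (map (@TGen S) (alt_word s' s m))).

Definition hecke_eq (S : eqType) (M : coxmat S) (L : S -> int) :=
  alg_eq (hecke_rel M L).

(* S/e : None is the new vertex s0, Some s for s in S \ {s+, s-} *)
Definition contr_type (S : eqType) (sp sm : S) : Type :=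
  option {s : S | (s != sp) && (s != sm)}.

Definition oadd (a b : option nat) : option nat :=
  match a, b with Some x, Some y => Some (x + y)%N | _, _ => None end.

Definition contr_edge_val (S : eqType) (M : coxmat S) (sp sm s : S) : option nat :=
  if (M s sp == Some 2%N) || (M s sm == Some 2%N)
  then omap (fun k => k - 2)%N (oadd (M s sp) (M s sm))
  else None.

Definition contr_mat (S : eqType) (M : coxmat S) (sp sm : S) :
    coxmat (contr_type sp sm) := fun x y =>
  match x, y with
  | None, None => Some 1%N
  | Some a, Some b => M (val a) (val b)
  | Some a, None => contr_edge_val M sp sm (val a)
  | None, Some a => contr_edge_val M sp sm (val a)
  end.

Definition contr_weight (S : eqType) (L : S -> int) (sp sm : S)
    (x : contr_type sp sm) : int :=
  match x with None => L sp | Some a => L (val a) end.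

Definition Tinv_term (S : eqType) (L : S -> int) (s : S) : term S :=
  TSub (TGen s) (TSub (vpow S (L s)) (vpow S (- L s))).

Fixpoint phi_v (S : eqType) (L : S -> int) (sp sm : S)
    (t : term (contr_type sp sm)) : term S :=
  match t with
  | T0 => T0 | T1 => T1 | TV => TV | TVi => TVi
  | TGen None => TMul (TMul (TGen sp) (TGen sm)) (Tinv_term L sp)
  | TGen (Some a) => TGen (val a)
  | TAdd x y => TAdd (phi_v L x) (phi_v L y)
  | TOpp x => TOpp (phi_v L x)
  | TMul x y => TMul (phi_v L x) (phi_v L y)
  end.
Arguments contr_mat {S} M sp sm.
Arguments contr_weight {S} L sp sm x.
Arguments phi_v {S} L {sp sm} t.

(* Main.v *)
Require Import Defs.
From HB Require Import structures.
From mathcomp Require Import all_boot all_algebra.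
From mathcomp Require Import zify boolp.
From Stdlib Require Import Reals Lra ClassicalEpsilon.
(* [Reals] makes [N] the key of the binary numbers. *)
Delimit Scope nat_scope with N.
Set Implicit Arguments. Unset Strict Implicit. Unset Printing Implicit Defensive.

(** Idea. Let [W] and [W'] be the Coxeter groups of [S] and [S/e]. The root [a_sp + a_sm] has
    the right inner products with the other simple roots for the span of it and of these roots
    to be a geometric representation of [W']; as such representations are faithful, [W'] embeds
    into [W] by [s0 |-> sp sm sp].
    If an element of the kernel of [phi_v] is written as [sum a_w T'_w] with Laurent polynomials
    [a_w], let it act on the dual of the regular module of [H_S], which has no torsion. At
    [v = 1] this action is that of [Z[W]], where the images of distinct [w] are independent, so
    every [a_w] vanishes at [v = 1]; dividing by [v - 1] and repeating, every [a_w] is divisible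
    by all powers of [v - 1], hence is zero. *)

(** * Dihedral subgroups in the reflection representation *)

(** For generic [v] the element [phi_v (T'_w)] is a combination of many [T_x], because of the factor
    [T_sp^-1]; it becomes a single group element only at [v = 1], which is why independence is
    tested there. The Hecke algebra is a bare presentation, so independence in [H_S] must come from
    a module. Functions constant on group elements provide one with explicit operators; their braid
    relations hold because right operators commute with left ones, which rests on the folding
    condition. In the source algebra [H_{S/e}] only spanning by the [T'_w] is used, and this follows
    from Matsumoto's theorem. *)

Arguments alt_word : simpl never.

Lemma alt_wordS (S : Type) (s t : S) k :
  alt_word s t k.+1 = s :: alt_word t s k.
Proof.
rewrite /alt_word /mkseq /= (iotaDl 1 0) -map_comp; congr (_ :: _).
by apply: eq_map => i /=; case: odd.
Qed.

Lemma size_alt_word (S : Type) (s t : S) k : size (alt_word s t k) = k.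
Proof. exact: size_mkseq. Qed.

Lemma alt_wordSr (S : Type) (s t : S) k :
  alt_word s t k.+1 = rcons (alt_word s t k) (if odd k then t else s).
Proof. by rewrite /alt_word mkseqS. Qed.

Lemma take_alt_word (S : Type) (s t : S) m k :
  m <= k -> take m (alt_word s t k) = alt_word s t m.
Proof. by move=> mk; rewrite /alt_word /mkseq -map_take take_iota (minn_idPl mk). Qed.

Lemma rev_alt_word (S : Type) (s t : S) k :
  rev (alt_word s t k) = if odd k then alt_word s t k else alt_word t s k.
Proof.
elim: k s t => [//|k IHk] s t.
by rewrite {1}alt_wordSr rev_rcons IHk /=; case: odd; rewrite /= alt_wordS.
Qed.

Lemma alt_word_map (S T : Type) (f : S -> T) s t k :
  map f (alt_word s t k) = alt_word (f s) (f t) k.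
Proof. by rewrite /alt_word /mkseq -map_comp; apply: eq_map => i /=; case: odd. Qed.

(* The sequence sin (k x) / sin x for d = 2 cos x. *)
Fixpoint cheb (d : R) (k : nat) : R :=
  match k with
  | 0 => 0%R
  | k'.+1 => match k' with 0 => 1%R | k''.+1 => (d * cheb d k' - cheb d k'')%R end
  end.

Lemma chebSS d k : cheb d k.+2 = (d * cheb d k.+1 - cheb d k)%R.
Proof. by []. Qed.

Lemma cheb_ge2 d k : (2 <= d)%R -> (0 <= cheb d k < cheb d k.+1)%R.
Proof.
move=> d2; elim: k => [|k IHk]; first by rewrite /=; lra.
by rewrite chebSS; nra.
Qed.

Lemma cheb_sin x k : (cheb (2 * cos x) k * sin x = sin (INR k * x))%R.
Proof.
elim/ltn_ind: k => -[|[|k]] IHk; first by rewrite /= !Rmult_0_l sin_0.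
  by rewrite /= !Rmult_1_l.
rewrite chebSS Rmult_minus_distr_r Rmult_assoc (IHk k.+1) // (IHk k) //.
have -> : (INR k.+2 * x = INR k.+1 * x + x)%R by rewrite (S_INR k.+1); lra.
have -> : (INR k * x = INR k.+1 * x - x)%R by rewrite (S_INR k); lra.
by rewrite sin_plus sin_minus; lra.
Qed.

Section FiniteOrder.
Variable m : nat.
Hypothesis m2 : (1 < m)%N.

Let x := (PI / INR m)%R.
Let mx : (INR m * x = PI)%R.
Proof. by rewrite /x; field; apply: not_0_INR; lia. Qed.
Let m2R : (2 <= INR m)%R.
Proof. by have := le_INR 2 m ltac:(lia); rewrite /=; lra. Qed.
Let x_gt0 : (0 < x)%R.
Proof. by have := PI_RGT_0; nra. Qed.
Let x_le : (2 * x <= PI)%R.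
Proof. by nra. Qed.
Let sinx_gt0 : (0 < sin x)%R.
Proof. by apply: sin_gt_0; lra. Qed.

Lemma cheb_gt0 k : (0 < k < m)%N -> (0 < cheb (2 * cos (PI / INR m)) k)%R.
Proof.
case/andP=> k0 km; have := cheb_sin x k.
have : (0 < sin (INR k * x))%R.
  have kR : (1 <= INR k)%R by have := le_INR 1 k ltac:(lia); rewrite /=; lra.
  have kmR : (INR k < INR m)%R by apply: lt_INR; lia.
  by apply: sin_gt_0; nra.
by rewrite -/x => ? ?; nra.
Qed.

Lemma cheb_order : cheb (2 * cos (PI / INR m)) m = 0%R.
Proof. by have := cheb_sin x m; rewrite mx sin_PI -/x => ?; nra. Qed.

Lemma cheb_order_pred : cheb (2 * cos (PI / INR m)) m.-1 = 1%R.
Proof.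
have := cheb_sin x m.-1.
have -> : (INR m.-1 * x = PI - x)%R.
  by have := S_INR m.-1; rewrite prednK; [move=> e; nra | lia].
rewrite sin_minus sin_PI cos_PI -/x => ?; nra.
Qed.

Lemma cos_order_bounds : (0 <= 2 * cos (PI / INR m) < 2)%R.
Proof.
split.
  by have := cos_ge_0 x; rewrite -/x => H; have := H ltac:(lra) ltac:(lra); lra.
have := sin2_cos2 x; rewrite /Rsqr -/x => ?; nra.
Qed.

Lemma cos_order_ge1 : (2 < m)%N -> (1 <= 2 * cos (PI / INR m))%R.
Proof.
move=> m3; have m3R : (3 <= INR m)%R by have := le_INR 3 m ltac:(lia); rewrite /=; lra.
have := cos_decr_1 x (PI / 3); rewrite cos_PI3 -/x => H.
have : (x <= PI / 3)%R by nra.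
by move=> ?; have := H ltac:(lra) ltac:(lra) ltac:(lra) ltac:(lra) ltac:(lra); lra.
Qed.

End FiniteOrder.

(* [-2] times the Tits form, allowing any value at most [-1] of the Tits form at an infinite [m]:
   the form that [M] induces on the contraction need not take the value [-1] there. *)
Definition coxeter_form (S : eqType) (M : coxmat S) (c : S -> S -> R) : Prop :=
  [/\ forall s, c s s = (-2)%R,
      forall s t, c s t = c t s,
      forall s t m, s != t -> M s t = Some m -> c s t = (2 * cos (PI / INR m))%R
    & forall s t, M s t = None -> (2 <= c s t)%R].

Definition below_order (k : nat) (o : option nat) : bool :=
  if o is Some m then (k < m)%N else true.

(* The contragredient of the reflection representation: [f s] is the value of the linear form [f]
   on the simple root of [s]. *)
Definition refl_act (S : Type) (c : S -> S -> R) (s : S) (f : S -> R) : S -> R :=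
  fun u => (f u + c s u * f s)%R.

Definition word_act (S : Type) (c : S -> S -> R) (w : seq S) (f : S -> R) : S -> R :=
  foldr (refl_act c) f w.

Lemma word_act_cons (S : Type) c (s : S) w f :
  word_act c (s :: w) f = refl_act c s (word_act c w f).
Proof. by []. Qed.

Arguments word_act : simpl never.

Lemma comb_gt0 a b x y : (0 <= a /\ 0 <= b /\ 0 < b + a ->
  0 < x -> 0 < y -> 0 < a * x + b * y)%R.
Proof.
case=> a0 [b0 ab] x0 y0; case: (Rle_lt_or_eq_dec 0 a a0) => a1.
  have := Rmult_lt_0_compat _ _ a1 x0; have := Rmult_le_pos _ _ b0 (Rlt_le _ _ y0); lra.
have b1 : (0 < b)%R by lra.
by have := Rmult_lt_0_compat _ _ b1 y0; rewrite -a1; lra.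
Qed.

Section Dihedral.
Variables (S : eqType) (M : coxmat S) (c : S -> S -> R).
Hypotheses (HM : is_coxeter_matrix M) (Hc : coxeter_form M c).
Local Notation act := (word_act c).

Lemma coxeter_matrix_gt1 s t m : s != t -> M s t = Some m -> (1 < m)%N.
Proof.
case: HM => _ [H1 H0] st Mst; case: m Mst => [/H0 //|[/H1 e|//]].
by rewrite e eqxx in st.
Qed.

(** Two consecutive values are the coordinates of a root of the dihedral subsystem in its two simple
    roots. Up to the order of [s t] both are nonnegative, and the strict sum says that they do not
    vanish together. *)
Lemma form_cheb s t k : s != t -> below_order k (M s t) ->
  (0 <= cheb (c s t) k /\ 0 <= cheb (c s t) k.+1 /\
   0 < cheb (c s t) k + cheb (c s t) k.+1)%R.
Proof.
move=> st; case: Hc => _ _ Hfin Hinf; rewrite /below_order.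
case E: (M s t) => [m|] => [km|_]; last first.
  by have := cheb_ge2 k (Hinf _ _ E) => ?; have := cheb_ge2 k.+1 (Hinf _ _ E); lra.
have m2 := coxeter_matrix_gt1 st E; rewrite (Hfin _ _ _ st E).
have Hle : (0 <= cheb (2 * cos (PI / INR m)) k.+1)%R.
  case: (ltngtP k.+1 m) => [km1|?|->]; last by rewrite cheb_order //; lra.
    by have := @cheb_gt0 m m2 k.+1 km1; lra.
  lia.
case: k km Hle => [|k] km Hle; first by rewrite /=; lra.
have := @cheb_gt0 m m2 k.+1 km; lra.
Qed.

Lemma act_cat w w' f : act (w ++ w') f = act w (act w' f).
Proof. exact: foldr_cat. Qed.

Lemma act_cons_self s w f : act (s :: w) f s = (- act w f s)%R.
Proof. by case: Hc => Hd _ _ _; rewrite word_act_cons /refl_act Hd; lra. Qed.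

Lemma act_sq s f : refl_act c s (refl_act c s f) = f.
Proof. by case: Hc => Hd _ _ _; apply: funext => u; rewrite /refl_act Hd; lra. Qed.

Lemma act_linear w f g (a b : R) :
  act w (fun u => (a * f u + b * g u)%R) = (fun u => (a * act w f u + b * act w g u)%R).
Proof.
elim: w => // s w IHw; rewrite word_act_cons IHw; apply: funext => u.
by rewrite !word_act_cons /refl_act; lra.
Qed.

(** The left side is [f] on the image of the simple root of [t] under the inverse word; its
    coordinates obey the recursion of [cheb]. *)
Lemma act_alt_word s t k f : s != t ->
  act (alt_word s t k) f t =
    (cheb (c s t) k.+1 * f (if odd k then s else t)
     + cheb (c s t) k * f (if odd k then t else s))%R.
Proof.
case: Hc => Hd Hs _ _.
elim/ltn_ind: k s t => -[|[|k]] IHk s t st.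
- by rewrite /alt_word /word_act /=; lra.
- by rewrite /alt_word /word_act /= /refl_act; lra.
rewrite alt_wordS word_act_cons {1}/refl_act (IHk k.+1) //; last by rewrite eq_sym.
rewrite alt_wordS act_cons_self IHk // (Hs t s) chebSS /= negbK.
by case: odd => /=; lra.
Qed.

Lemma act_alt_word_gt0 s t k f : s != t -> below_order k (M s t) ->
  (0 < f s)%R -> (0 < f t)%R -> (0 < act (alt_word s t k) f t)%R.
Proof.
move=> st kM fs ft; have [? [? ?]] := form_cheb st kM.
by rewrite act_alt_word //; apply: comb_gt0 => //; case: odd.
Qed.

Lemma act_alt_word_lt0 s t k f : s != t -> below_order k (M s t) ->
  (f s < 0)%R -> (f t < 0)%R -> (act (alt_word s t k) f t < 0)%R.
Proof.
move=> st kM fs ft.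
have := @act_alt_word_gt0 s t k (fun u => ((-1) * f u + 0 * f u)%R) st kM.
by rewrite act_linear => H; have := H ltac:(lra) ltac:(lra); lra.
Qed.

Lemma act_dihedral_braid s t m f : s != t -> M s t = Some m ->
  act (alt_word s t m) f t = act (alt_word t s m) f t.
Proof.
move=> st Mst; have m2 := coxeter_matrix_gt1 st Mst.
rewrite act_alt_word //; case: (m) m2 Mst => // j j1 Mst.
rewrite (alt_wordS t) act_cons_self act_alt_word //.
case: Hc => _ _ Hf _; rewrite (Hf _ _ _ st Mst) chebSS.
have := cheb_order j1; have := cheb_order_pred j1; rewrite /= => -> ->.
by case: odd => /=; lra.
Qed.

(* As the form is nondegenerate on the plane of [s] and [t], some [f u + a f s + b f t]
   is invariant under both reflections; so only the coordinates [s] and [t] matter. *)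
Lemma act_braid s t m : s != t -> M s t = Some m ->
  act (alt_word s t m) = act (alt_word t s m).
Proof.
move=> st Mst; apply: funext => f; apply: funext => u.
have m2 := coxeter_matrix_gt1 st Mst; case: (Hc) => Hd Hs Hf _.
have := cos_order_bounds m2; rewrite -(Hf _ _ _ st Mst) => cb.
set d := c s t in cb.
(* Invariance of [l] below means [2 a - d b = c s u] and [2 b - d a = c t u]; [D] is the determinant
   of this system. *)
set D := (4 - d * d)%R; have D0 : (D <> 0)%R by rewrite /D; nra.
pose a := ((2 * c s u + d * c t u) / D)%R.
pose b := ((2 * c t u + d * c s u) / D)%R.
pose l g := (g u + a * g s + b * g t)%R.
have ls g : l (refl_act c s g) = l g.
  rewrite /l /refl_act Hd -/d /a /b; field_simplify => //.
  by congr (_ / _)%R; rewrite /D; ring.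
have lt g : l (refl_act c t g) = l g.
  rewrite /l /refl_act Hd (Hs t s) -/d /a /b; field_simplify => //.
  by congr (_ / _)%R; rewrite /D; ring.
have la p q k g : (forall h, l (refl_act c p h) = l h) ->
    (forall h, l (refl_act c q h) = l h) -> l (act (alt_word p q k) g) = l g.
  elim: k p q => [//|k IHk] p q lp lq; rewrite alt_wordS word_act_cons lp; exact: IHk.
have := la s t m f ls lt; rewrite -(la t s m f lt ls) /l.
rewrite (act_dihedral_braid f st Mst).
have ts : t != s by rewrite eq_sym.
have Mts : M t s = Some m by case: HM => ->.
by rewrite (act_dihedral_braid f ts Mts); lra.
Qed.

Lemma act_cox_eq w w' : cox_eq M w w' -> act w = act w'.
Proof.
elim=> //.
- by move=> ? ? ? _ -> _ ->.
- by move=> u1 u2 w1 w2 _ IH1 _ IH2; apply: funext => f; rewrite !act_cat IH1 IH2.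
- by move=> s; apply: funext => f; rewrite !word_act_cons act_sq.
- exact: act_braid.
Qed.

End Dihedral.

(** * Length and the sign of roots *)

Section CoxeterLength.
Variables (S : eqType) (M : coxmat S).
Local Notation "u ~ w" := (cox_eq M u w) (at level 70).

Lemma cox_cons s u w : u ~ w -> s :: u ~ s :: w.
Proof. by move=> uw; exact: (cox_cat (cox_refl M [:: s]) uw). Qed.

Lemma cox_catl v u w : u ~ w -> v ++ u ~ v ++ w.
Proof. exact: (cox_cat (cox_refl M v)). Qed.

Lemma cox_catr v u w : u ~ w -> u ++ v ~ w ++ v.
Proof. by move=> uw; exact: (cox_cat uw (cox_refl M v)). Qed.

Lemma cox_sq_cons s w : s :: s :: w ~ w.
Proof. exact: (cox_catr w (cox_sq M s)). Qed.

Lemma cox_revl w : rev w ++ w ~ [::].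
Proof.
elim: w => [|s w IHw]; first exact: cox_refl.
rewrite rev_cons cat_rcons; apply: cox_trans IHw.
by apply: cox_catl; apply: cox_sq_cons.
Qed.

Lemma cox_revr w : w ++ rev w ~ [::].
Proof. by have := cox_revl (rev w); rewrite revK. Qed.

Lemma cox_cancel v u w : v ++ u ~ v ++ w -> u ~ w.
Proof.
have H x : x ~ rev v ++ v ++ x.
  by apply: cox_sym; rewrite catA; exact: (cox_catr x (cox_revl v)).
move=> /(cox_catl (rev v)) vuw; apply: cox_trans (H u) _.
by apply: cox_trans vuw _; apply: cox_sym.
Qed.

Lemma cox_rev u w : u ~ w -> rev u ~ rev w.
Proof.
elim=> {u w} [w|u w _|u v w _ IHu _|u1 u2 w1 w2 _ IHu _ IHw|s|s t m st Mst].
- exact: cox_refl.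
- exact: cox_sym.
- exact: cox_trans.
- by rewrite !rev_cat; exact: cox_cat.
- exact: cox_sq.
- rewrite !rev_alt_word; case: odd; first exact: cox_braid.
  exact/cox_sym/cox_braid.
Qed.

Lemma cox_odd_size u w : u ~ w -> odd (size u) = odd (size w).
Proof.
elim=> //.
- by move=> ? ? ? _ -> _ ->.
- by move=> u1 u2 w1 w2 _ IHu _ IHw; rewrite !size_cat !oddD IHu IHw.
- by move=> *; rewrite !size_alt_word.
Qed.

Lemma cox_len_ex w : exists n, `[< exists2 u, w ~ u & size u = n >].
Proof. by exists (size w); apply/asboolP; exists w => //; exact: cox_refl. Qed.

Definition cox_len w := ex_minn (cox_len_ex w).

Lemma cox_len_le u w : w ~ u -> cox_len w <= size u.
Proof.
by move=> wu; rewrite /cox_len; case: ex_minnP => m _; apply; apply/asboolP; exists u.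
Qed.

Lemma cox_len_min w : exists2 u, w ~ u & size u = cox_len w.
Proof. by rewrite /cox_len; case: ex_minnP => m /asboolP. Qed.

Lemma cox_len_eq u w : u ~ w -> cox_len u = cox_len w.
Proof.
move=> uw; apply/eqP; rewrite eqn_leq; apply/andP; split.
  by have [x wx <-] := cox_len_min w; apply: cox_len_le; apply: cox_trans wx.
by have [x ux <-] := cox_len_min u; apply: cox_len_le; apply: cox_trans ux; exact: cox_sym.
Qed.

Lemma cox_len_le_size w : cox_len w <= size w.
Proof. exact/cox_len_le/cox_refl. Qed.

Lemma cox_len_odd w : odd (cox_len w) = odd (size w).
Proof. by have [x wx <-] := cox_len_min w; rewrite (cox_odd_size wx). Qed.

Lemma cox_len_cat u w : cox_len (u ++ w) <= size u + cox_len w.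
Proof.
have [x wx <-] := cox_len_min w; rewrite -size_cat; apply: cox_len_le.
exact: cox_catl.
Qed.

(** All relations preserve the parity of the size, so the two lengths, which differ by at most one,
    cannot be equal. *)
Lemma cox_len_cons s w :
  cox_len (s :: w) = (cox_len w).+1 \/ cox_len w = (cox_len (s :: w)).+1.
Proof.
have := cox_len_cat [:: s] w; have := cox_len_cat [:: s] (s :: w).
rewrite /= (cox_len_eq (cox_sq_cons s w)).
have := cox_len_odd (s :: w); have := cox_len_odd w; rewrite /=.
by move=> <-; lia.
Qed.

Lemma cox_len0 w : cox_len w = 0 -> w ~ [::].
Proof. by have [x wx <-] := cox_len_min w => /size0nil xn; rewrite xn in wx. Qed.

Lemma cox_len_pos w : 0 < cox_len w ->
  exists s u, w ~ s :: u /\ cox_len w = (cox_len u).+1.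
Proof.
have [[|s u] wx wl] := cox_len_min w; first by rewrite -wl.
move=> _; exists s, u; split=> //; apply/eqP; rewrite eqn_leq.
rewrite -{2}wl /= ltnS cox_len_le_size (cox_len_eq wx).
by have := cox_len_cat [:: s] u => /= ->.
Qed.

(** The letters [s], [t], [s], ... are stripped from the left as long as each one shortens the word;
    the next letter of the alternation then lengthens the rest. *)
Lemma cox_alt_strip s t w : exists k w1,
  [/\ w ~ alt_word s t k ++ w1, cox_len w = k + cox_len w1
    & cox_len ((if odd k then t else s) :: w1) = (cox_len w1).+1].
Proof.
have [n] : exists n, cox_len w <= n by exists (cox_len w).
elim: n w s t => [|n IHn] w s t wn; case: (cox_len_cons s w) => [sw|sw].
- by exists 0, w; split=> //; exact: cox_refl.
- by rewrite sw in wn.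
- by exists 0, w; split=> //; exact: cox_refl.
have [] := IHn (s :: w) t s; first by lia.
move=> k [w1 [e1 e2 e3]]; exists k.+1, w1; split; last first.
- by rewrite /=; case: (odd k) e3.
- by rewrite sw e2.
rewrite alt_wordS /=; apply: cox_trans (cox_sym (cox_sq_cons s w)) _.
exact: cox_cons.
Qed.

End CoxeterLength.

Section Tits.
Variables (S : eqType) (M : coxmat S) (c : S -> S -> R).
Hypotheses (HM : is_coxeter_matrix M) (Hc : coxeter_form M c).
Local Notation act := (word_act c).
Local Notation "u ~ w" := (cox_eq M u w) (at level 70).
Local Notation len := (cox_len M).

Definition dominant (f : S -> R) := forall s, (0 < f s)%R.

(** The braid relation turns the first [m] letters of the alternating word into a word that starts
    with [s], which cancels the [s] in front. *)
Lemma cox_braid_absorb s t k m w1 : s != t -> M s t = Some m -> m <= k ->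
  len (s :: alt_word t s k ++ w1) < k + len w1.
Proof.
move=> st Mst mk; have m2 := coxeter_matrix_gt1 HM st Mst.
have ts : t != s by rewrite eq_sym.
have Mts : M t s = Some m by case: HM => ->.
set z := drop m (alt_word t s k).
have sz : size z = k - m by rewrite /z size_drop size_alt_word.
have -> : alt_word t s k = alt_word t s m ++ z.
  by rewrite -(take_alt_word t s mk) cat_take_drop.
have -> : len (s :: (alt_word t s m ++ z) ++ w1) = len (alt_word t s m.-1 ++ z ++ w1).
  apply: cox_len_eq; rewrite -catA.
  apply: cox_trans (cox_cons s (cox_catr (z ++ w1) (cox_braid ts Mts))) _.
  case: (m) m2 => // j _; rewrite alt_wordS; exact: cox_sq_cons.
rewrite catA; apply: leq_ltn_trans (cox_len_cat _ _ _) _.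
rewrite size_cat sz size_alt_word; lia.
Qed.

(** Tits's induction on the length: [w] is an alternating word in [t] and [s] times a shorter [w1]
    that both letters lengthen. By induction [act w1 f] is positive at both, and the rank two
    computation carries this over to [w]. *)
Theorem tits_positive s w f : len (s :: w) = (len w).+1 -> dominant f ->
  (0 < act w f s)%R.
Proof.
move=> + f0; have [n] : exists n, len w = n by exists (len w).
elim/ltn_ind: n w s => n IHn w s wn; rewrite -{}wn in IHn.
case: (posnP (len w)) => [w0 _|].
  by rewrite (act_cox_eq HM Hc (cox_len0 w0)); exact: f0.
case/cox_len_pos => t [w' [ww' lw]] sw; have tw' := cox_len_eq ww'.
have st : s != t.
  apply: contra_eq_neq sw => ->; rewrite (cox_len_eq (cox_cons t ww')).
  by rewrite (cox_len_eq (cox_sq_cons _ _ _)); lia.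
have [k [w1 [wk lk rk]]] := cox_alt_strip M t s w.
(* [t] is a left descent of [w], so at least one letter is stripped. *)
case: k wk lk rk => [|k] wk lk rk.
  have e : len (t :: w1) = len w'.
    rewrite (cox_len_eq (cox_cons t (cox_sym wk))) (cox_len_eq (cox_cons t ww')).
    exact: cox_len_eq (cox_sq_cons _ _ _).
  by move: rk; rewrite /= e; lia.
have Hother : len ((if odd k then s else t) :: w1) = (len w1).+1.
  have : len w <= k + len ((if odd k then s else t) :: w1).
    rewrite (cox_len_eq wk) alt_wordSr cat_rcons -[X in _ <= X + _](size_alt_word t s).
    exact: cox_len_cat.
  by case: (cox_len_cons M (if odd k then s else t) w1); lia.
have [p1 p2] : (0 < act w1 f s)%R /\ (0 < act w1 f t)%R.
  have H s' := IHn (len w1) ltac:(lia) w1 s' erefl.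
  by move: rk Hother => /=; case: odd => /= r1 r2; split; apply: H.
rewrite (act_cox_eq HM Hc wk) act_cat; apply: (act_alt_word_gt0 HM Hc) => //.
  by rewrite eq_sym.
case: HM => Msym _; rewrite Msym.
rewrite /below_order; case E: (M s t) => [m|//]; rewrite ltnNge; apply/negP => mk.
have := cox_braid_absorb w1 st E mk.
by rewrite -(cox_len_eq (cox_cons s wk)) -lk; lia.
Qed.

Lemma tits_negative s w f : len w = (len (s :: w)).+1 -> dominant f ->
  (act w f s < 0)%R.
Proof.
move=> sw f0; have : len (s :: s :: w) = (len (s :: w)).+1.
  by rewrite (cox_len_eq (cox_sq_cons _ _ _)).
by move=> /tits_positive /(_ f0); rewrite (act_cons_self Hc); lra.
Qed.

Lemma act_sign s w f g : dominant f -> dominant g ->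
  (0 < act w f s)%R -> (0 < act w g s)%R.
Proof.
move=> f0 g0; case: (cox_len_cons M s w) => H; first by have := tits_positive H g0.
by have := tits_negative H f0; lra.
Qed.

Lemma act_neq0 s w f : dominant f -> (act w f s <> 0)%R.
Proof.
by move=> f0; case: (cox_len_cons M s w) =>
  [/tits_positive|/tits_negative] /(_ _ f0); lra.
Qed.

(** A dominant form has trivial stabilizer: a nontrivial element has a left descent, and there its
    image of the form is negative. *)
Lemma act_faithful u w f : dominant f -> act u f = act w f -> u ~ w.
Proof.
move=> f0 uw; have H : act (rev w ++ u) f = f.
  by rewrite act_cat uw -act_cat (act_cox_eq HM Hc (cox_revl M w)).
apply: (@cox_cancel _ _ (rev w)); apply: cox_trans (cox_sym (cox_revl M w)).
case: (posnP (len (rev w ++ u))) => [/cox_len0 //|].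
case/cox_len_pos => t [w' [ww' lw]].
have : (act (rev w ++ u) f t < 0)%R.
  apply: tits_negative => //; rewrite (cox_len_eq (cox_cons t ww')).
  by rewrite (cox_len_eq (cox_sq_cons _ _ _)).
by rewrite H; have := f0 t; lra.
Qed.

End Tits.

(** * The folding condition and Matsumoto's theorem *)

Section Exchange.
Variables (S : eqType) (M : coxmat S) (c : S -> S -> R).
Hypotheses (HM : is_coxeter_matrix M) (Hc : coxeter_form M c).
Local Notation act := (word_act c).
Local Notation "u ~ w" := (cox_eq M u w) (at level 70).
Local Notation len := (cox_len M).

Let one : S -> R := fun=> 1%R.
Let one_gt0 : dominant one.
Proof. by move=> s; rewrite /one; lra. Qed.

Lemma descent_neg s w : len (s :: w) < len w -> (act w one s < 0)%R.
Proof. by case: (cox_len_cons M s w) => [|/(tits_negative HM Hc)/(_ one_gt0) //]; lia. Qed.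

Lemma ascent_pos s w : ~~ (len (s :: w) < len w) -> (0 < act w one s)%R.
Proof. by case: (cox_len_cons M s w) => [/(tits_positive HM Hc)/(_ one_gt0) //|]; lia. Qed.

(** Invariance of the form under the group, as [c u] is the pairing with the simple root of [u]. *)
Lemma act_form_sym w t u : act w (c u) t = act (rev w) (c t) u.
Proof.
case: Hc => _ Hs _ _; elim: w t => [|s w IHw] t; first exact: Hs.
rewrite word_act_cons /refl_act !IHw rev_cons -cats1 act_cat.
have -> : act [:: s] (c t) = fun x => (1 * c t x + c t s * c s x)%R.
  by apply: funext => x; rewrite word_act_cons /refl_act /word_act /=; lra.
by rewrite act_linear (Hs s t); lra.
Qed.

Section Fold.
Variables (s t : S) (w : seq S).
Hypotheses (H1 : (0 < act w one t)%R) (H2 : (act (w ++ [:: s]) one t < 0)%R).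

(** The forms [g + e one] with [e > 0] are dominant, so at [t] their images are positive under [w]
    and negative under [w s]. As [s] fixes [g], both values tend to [act w g t] when [e] tends to
    0. *)
Let fold_facet g : (forall u, u != s -> 0 < g u)%R -> g s = 0%R -> act w g t = 0%R.
Proof.
move=> g0 gs; have dom e : (0 < e)%R -> dominant (fun u => (1 * g u + e * one u)%R).
  move=> e0 u; rewrite /one; case: (eqVneq u s) => [->|/g0]; rewrite ?gs; lra.
have sg : act [:: s] g = g.
  by apply: funext => u; rewrite word_act_cons /refl_act /word_act /= gs; lra.
have P e : (0 < e)%R -> (0 < act w g t + e * act w one t)%R.
  move=> e0; have := act_sign HM Hc one_gt0 (dom e e0) H1.
  by rewrite act_linear; lra.
have N e : (0 < e)%R -> (act w g t + e * act (w ++ [:: s]) one t < 0)%R.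
  move=> e0; case: (Rlt_le_dec (act (w ++ [:: s]) (fun u => (1 * g u + e * one u)%R) t) 0).
    by rewrite act_linear [X in act X g]cats1 -cats1 act_cat sg; lra.
  move=> ge0; have n0 := act_neq0 HM Hc (s := t) (w := w ++ [:: s]) (dom e e0).
  have := act_sign HM Hc (dom e e0) one_gt0 (s := t) (w := w ++ [:: s]).
  by move=> /(_ ltac:(lra)); lra.
have B0 := H1; have B'0 := H2.
set A := act w g t in P N *; set B := act w one t in B0 P *.
set B' := act _ one t in B'0 N *.
case: (Rtotal_order A 0) => [A0|[//|A0]].
  (* For this [e] the sum in [P] would be [A / 2], which is negative; the last case treats [N] in
     the same way. *)
  have e0 : (0 < - A / (2 * B))%R by apply: Rdiv_lt_0_compat; lra.
  have := P _ e0; have -> : (- A / (2 * B) * B = - A / 2)%R by field; lra.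
  lra.
have e0 : (0 < A / (- (2 * B')))%R by apply: Rdiv_lt_0_compat; lra.
have := N _ e0; have -> : (A / (- (2 * B')) * B' = - A / 2)%R by field; lra.
lra.
Qed.

Let delta : S -> R := fun u => if u == s then 1%R else 0%R.

(* A positive root made negative by the reflection [s] is a multiple of the root of [s]:
   as a functional it vanishes on the wall [f s = 0] of the fundamental chamber. *)
Let fold_root f : act w f t = (act w delta t * f s)%R.
Proof.
pose g := fun u => (1 * f u + - f s * delta u)%R.
have gs : g s = 0%R by rewrite /g /delta eqxx; lra.
(* [g] vanishes at [s] but has arbitrary signs elsewhere; it is the difference of [g1] and [g2], to
   which [fold_facet] applies. *)
pose g1 u := if u == s then 0%R else (Rabs (g u) + 1)%R.
pose g2 u := (1 * g1 u + -1 * g u)%R.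
have z1 : act w g1 t = 0%R.
  apply: fold_facet; last by rewrite /g1 eqxx.
  by move=> u us; rewrite /g1 (negbTE us); have := Rabs_pos (g u); lra.
have z2 : act w g2 t = 0%R.
  apply: fold_facet; last by rewrite /g2 /g1 eqxx gs; lra.
  by move=> u us; rewrite /g2 /g1 (negbTE us); have := Rle_abs (g u); lra.
have : act w g t = 0%R.
  by move: z2; rewrite /g2 act_linear z1; lra.
by rewrite /g act_linear; lra.
Qed.

(** By [fold_root] the root of [t] is a positive multiple [k] of the image under [w] of the root of
    [s]. Both have the same norm, so [k = 1] and [w] conjugates [s] to [t]. *)
Lemma fold_eq : t :: w ~ w ++ [:: s].
Proof.
case: (Hc) => Hd Hs _ _; have root := fold_root.
set k := act w delta t in root.
have k0 : (0 < k)%R by have := root one; rewrite {2}/one; lra.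
have e1 : act (rev w) (c t) = fun u => (k * c s u + 0 * one u)%R.
  by apply: funext => u; rewrite -act_form_sym root (Hs u s); lra.
have e2 u : c t u = (k * act w (c s) u)%R.
  have : act w (act (rev w) (c t)) = c t.
    by rewrite -act_cat (act_cox_eq HM Hc (cox_revr M w)).
  by rewrite e1 act_linear => <-; lra.
have k1 : k = 1%R by have := e2 t; rewrite root !Hd; nra.
apply: (act_faithful HM Hc one_gt0); rewrite act_cat.
have -> : act [:: s] one = fun u => (1 * one u + 1 * c s u)%R.
  by apply: funext => u; rewrite word_act_cons /refl_act /word_act /= /one; lra.
rewrite act_linear; apply: funext => u; rewrite word_act_cons /refl_act e2.
by rewrite root k1 {2}/one; lra.
Qed.

End Fold.

Lemma cox_fold s t w : ~~ (len (t :: w) < len w) ->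
  len (t :: w ++ [:: s]) < len (w ++ [:: s]) -> t :: w ~ w ++ [:: s].
Proof. by move=> /ascent_pos H1 /descent_neg H2; exact: fold_eq. Qed.

(** [act w one] is negative at [s] and at [t]. By the rank two computation the next letter of the
    alternation thus stays a descent until [m] letters are stripped; for infinite [m] this would
    exceed the length of [w]. *)
Lemma cox_alt_descents s t w : s != t ->
  len (s :: w) < len w -> len (t :: w) < len w ->
  exists m w1, [/\ M s t = Some m, w ~ alt_word s t m ++ w1 & len w = m + len w1].
Proof.
move=> st /descent_neg ws /descent_neg wt.
have strip k : (if M s t is Some m then k <= m else true) ->
    exists2 w1, w ~ alt_word s t k ++ w1 & len w = k + len w1.
  elim: k => [|k IHk] km; first by exists w => //; exact: cox_refl.
  have km' : below_order k (M s t) by rewrite /below_order; case: (M s t) km.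
  have [|w1 ww1 lw1] := IHk; first by case: (M s t) km => // m; lia.
  set r := if odd k then t else s.
  have neg : (act w1 one r < 0)%R.
    have -> : act w1 one = act (rev (alt_word s t k)) (act w one).
      rewrite (act_cox_eq HM Hc ww1) -act_cat catA act_cat.
      by rewrite (act_cox_eq HM Hc (cox_revl M _)).
    rewrite rev_alt_word /r; case: odd; apply: (act_alt_word_lt0 HM Hc) => //.
      by rewrite eq_sym.
    by case: HM => ->.
  exists (r :: w1).
    rewrite alt_wordSr cat_rcons; apply: cox_trans ww1 _; apply: cox_catl.
    exact/cox_sym/cox_sq_cons.
  have : len (r :: w1) < len w1.
    by apply: contraT => /ascent_pos; lra.
  by case: (cox_len_cons M r w1); lia.
case E: (M s t) strip => [m|] strip.
  by have [w1 ? ?] := strip m (leqnn m); exists m, w1.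
by have [w1 _] := strip (len w).+1 isT; lia.
Qed.

Lemma reduced_cons s u : len (s :: u) = size (s :: u) -> len u = size u.
Proof. by have := cox_len_le_size M u; case: (cox_len_cons M s u) => /=; lia. Qed.

(** Induction on the size. If the first letters [s] and [t] differ, both are descents, so there are
    reduced words that begin with the two sides of their braid relation. Each given word is compared
    by induction with the one that shares its first letter. *)
Theorem matsumoto (A : Type) (idx : A) (op : Monoid.law idx) (T : S -> A) :
    (forall s t m, s != t -> M s t = Some m ->
       \big[op/idx]_(x <- alt_word s t m) T x = \big[op/idx]_(x <- alt_word t s m) T x) ->
  forall u w, len u = size u -> len w = size w -> u ~ w ->
  \big[op/idx]_(x <- u) T x = \big[op/idx]_(x <- w) T x.
Proof.
move=> Tbraid u; have [n] : exists n, size u = n by exists (size u).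
elim: n u => [|n IHn] u su w lu lw uw; have luw := cox_len_eq uw.
  by rewrite (size0nil su) (size0nil (s := w)) // -lw -luw lu.
case: u su lu uw luw => [//|s u] [su] lsu uw luw.
case: w lw uw luw => [|t w] ltw uw luw; first by rewrite ltw in luw; rewrite luw in lsu.
have lu := reduced_cons lsu; have lw := reduced_cons ltw.
rewrite !big_cons; case: (eqVneq s t) uw luw => [<-|st] uw luw.
  by congr (op _ _); apply: IHn => //; exact: (cox_cancel (v := [:: s]) uw).
have [||m [z [Mst uz lz]]] := @cox_alt_descents s t (s :: u) st.
- by rewrite (cox_len_eq (cox_sq_cons M s u)) lu lsu.
- by rewrite (cox_len_eq (cox_cons t uw)) (cox_len_eq (cox_sq_cons M t w)) lw lsu -lsu luw ltw.
have m2 := coxeter_matrix_gt1 HM st Mst; case: m m2 Mst uz lz => // m _ Mst uz lz.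
have [z' zz' lz'] := cox_len_min M z.
have {}uz : s :: u ~ alt_word s t m.+1 ++ z' by apply: cox_trans uz (cox_catl _ zz').
have wz : t :: w ~ alt_word t s m.+1 ++ z'.
  apply: cox_trans (cox_sym uw) _; apply: cox_trans uz _.
  by apply: cox_catr; exact: cox_braid.
have IH p q x : p :: x ~ alt_word p q m.+1 ++ z' -> size x = n -> len x = size x ->
    op (T p) (\big[op/idx]_(y <- x) T y) =
    \big[op/idx]_(y <- alt_word p q m.+1 ++ z') T y.
  rewrite alt_wordS /= => xz sx lx; rewrite big_cons; congr (op _ _).
  have xz' := cox_cancel (v := [:: p]) xz.
  apply: IHn => //; rewrite -(cox_len_eq xz') lx size_cat size_alt_word lz'.
  by move: lz; rewrite lsu /=; lia.
rewrite (IH s t) // (IH t s) //; last first.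
  by move: luw; rewrite lsu ltw /= su => -[].
by rewrite !big_cat Tbraid.
Qed.

End Exchange.

(** * The regular module of the Hecke algebra *)

Import GRing.Theory.

Section LengthSymmetry.
Variables (S : eqType) (M : coxmat S) (c : S -> S -> R).
Hypotheses (HM : is_coxeter_matrix M) (Hc : coxeter_form M c).
Local Notation "u ~ w" := (cox_eq M u w) (at level 70).
Local Notation len := (cox_len M).

Lemma cox_len_rev w : len (rev w) = len w.
Proof.
have H u : len (rev u) <= len u.
  by have [x ux <-] := cox_len_min M u; rewrite -(size_rev x); exact/cox_len_le/cox_rev.
by apply/eqP; rewrite eqn_leq H -{1}(revK w) H.
Qed.

Lemma cox_len_rcons w s : len (w ++ [:: s]) = len (s :: rev w).
Proof. by rewrite -cox_len_rev rev_cat. Qed.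

Lemma cox_len_cons_neq t w : len (t :: w) != len w.
Proof. by case: (cox_len_cons M t w); lia. Qed.

(** Both implications are the folding condition, once for [w] and once for [w s]. *)
Lemma left_descent_stable t s w : ~ t :: w ~ w ++ [:: s] ->
  (len (t :: w ++ [:: s]) < len (w ++ [:: s])) = (len (t :: w) < len w).
Proof.
move=> nE; have wss : (w ++ [:: s]) ++ [:: s] ~ w.
  by rewrite -catA -[X in _ ~ X]cats0; exact: (cox_catl w (cox_sq M s)).
apply/idP/idP => [H|H]; apply: contraT => nH; case: nE.
  exact: (cox_fold HM Hc nH H).
apply/cox_sym; apply: (cox_cancel (v := [:: t])).
apply: cox_trans (cox_sym (cox_sq_cons M t w)); apply: cox_trans (wss).
apply: (cox_fold HM Hc nH); rewrite (cox_len_eq wss).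
by rewrite (cox_len_eq (cox_cons t wss)).
Qed.

Lemma right_descent_stable t s w : ~ t :: w ~ w ++ [:: s] ->
  (len (t :: w ++ [:: s]) < len (t :: w)) = (len (w ++ [:: s]) < len w).
Proof.
move=> nE; have := @left_descent_stable s t (rev w).
have -> : rev w ++ [:: t] = rev (t :: w) by rewrite rev_cons -cats1.
rewrite -!cox_len_rcons !cox_len_rev => <- //.
by move=> /(cox_rev) H; apply: nE; move: H; rewrite revK rev_cons revK -cats1 => /cox_sym.
Qed.

Lemma alt_word_reduced s t k : s != t -> (if M s t is Some m then k <= m else true) ->
  len (alt_word s t k) = k.
Proof.
elim: k s t => [|k IHk] s t st km; first by apply/eqP; rewrite -leqn0 (cox_len_le_size M).
have Mts : M t s = M s t by case: HM => ->.
have ts : t != s by rewrite eq_sym.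
have IH : len (alt_word t s k) = k.
  by apply: IHk => //; rewrite Mts; case: (M s t) km => // m; lia.
rewrite alt_wordS; case: (cox_len_cons M s (alt_word t s k)); rewrite IH // => d.
have [] : ~ len (s :: alt_word t s k) < len (alt_word t s k).
  move=> /(descent_neg HM Hc).
  have : below_order k (M t s) by rewrite Mts /below_order; case: (M s t) km.
  by move=> /(act_alt_word_gt0 HM Hc ts)/(_ Rlt_0_1 Rlt_0_1); lra.
by rewrite IH; lia.
Qed.

End LengthSymmetry.

From mathcomp Require Import ring.

Section HeckeModule.
Local Open Scope ring_scope.
Variables (S : eqType) (M : coxmat S) (L : S -> int).
Variables (K : comNzRingType) (v vi : K).

Definition zpow (k : int) : K :=
  match k with Posz n => v ^+ n | Negz n => vi ^+ n.+1 end.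

Definition hecke_param (s : S) : K := zpow (L s) - zpow (- L s).

(** The transpose of [T_w |-> T_w T_s], where [T_w T_s] is [T_{ws}], plus [(v_s - v_s^-1) T_w] if
    [s] shortens [w]. *)
Definition right_mul (s : S) (F : seq S -> K) (w : seq S) : K :=
  F (w ++ [:: s]) +
  (if (cox_len M (w ++ [:: s]) < cox_len M w)%N then hecke_param s * F w else 0).

Definition left_mul (t : S) (F : seq S -> K) (w : seq S) : K :=
  F (t :: w) +
  (if (cox_len M (t :: w) < cox_len M w)%N then hecke_param t * F w else 0).

(* The dual of the right regular module of the Hecke algebra, as functions on words. *)
Fixpoint hecke_act (x : term S) (F : seq S -> K) : seq S -> K :=
  match x with
  | T0 => fun=> 0
  | T1 => F
  | TV => fun w => v * F w
  | TVi => fun w => vi * F w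
  | TGen s => right_mul s F
  | TAdd x y => fun w => hecke_act x F w + hecke_act y F w
  | TOpp x => fun w => - hecke_act x F w
  | TMul x y => hecke_act x (hecke_act y F)
  end.

Definition class_fun (F : seq S -> K) := forall u w, cox_eq M u w -> F u = F w.

Lemma right_mul_class s F : class_fun F -> class_fun (right_mul s F).
Proof.
move=> HF u w uw; rewrite /right_mul (HF _ _ uw) (HF _ _ (cox_catr [:: s] uw)).
by rewrite (cox_len_eq uw) (cox_len_eq (cox_catr [:: s] uw)).
Qed.

Lemma left_mul_class s F : class_fun F -> class_fun (left_mul s F).
Proof.
move=> HF u w uw; rewrite /left_mul (HF _ _ uw) (HF _ _ (cox_cons s uw)).
by rewrite (cox_len_eq uw) (cox_len_eq (cox_cons s uw)).
Qed.

Lemma hecke_act_class x F : class_fun F -> class_fun (hecke_act x F).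
Proof.
elim: x F => [|||||x IHx y IHy|x IHx|x IHx y IHy] //= => [||s|||] F HF.
- by move=> u w /HF ->.
- by move=> u w /HF ->.
- exact: right_mul_class.
- by move=> u w uw; rewrite (IHx F HF u w uw) (IHy F HF u w uw).
- by move=> u w uw; rewrite (IHx F HF u w uw).
- exact/IHx/IHy.
Qed.

Lemma hecke_act_linear x F G (a b : K) :
  hecke_act x (fun w => a * F w + b * G w) =
  fun w => a * hecke_act x F w + b * hecke_act x G w.
Proof.
elim: x F G a b => [|||||x IHx y IHy|x IHx|x IHx y IHy] /= => [||||s|||] F G a b;
  apply: funext => w.
- by rewrite !mulr0 addr0.
- by [].
- by ring.
- by ring.
- by rewrite /right_mul; case: ifP => _; ring.
- by rewrite IHx IHy; ring.
- by rewrite IHx; ring.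
- by rewrite IHy IHx.
Qed.

Lemma hecke_act_vpow k F : hecke_act (vpow S k) F = fun w => zpow k * F w.
Proof.
have H (x : term S) a n : (forall G, hecke_act x G = fun w => a * G w) ->
    hecke_act (iter n (TMul x) T1) F = fun w => a ^+ n * F w.
  move=> Hx; elim: n => [|n IHn] /=; apply: funext => w; first by rewrite mul1r.
  by rewrite IHn Hx exprS mulrA.
by case: k => n; apply: H.
Qed.

Lemma hecke_act_gens w F :
  hecke_act (tprod (map (@TGen S) w)) F = foldr right_mul F w.
Proof. by elim: w => //= s w ->. Qed.

Variable c : S -> S -> R.
Hypotheses (HM : is_coxeter_matrix M) (Hc : coxeter_form M c) (HL : is_weight M L).
Hypothesis v_unit : v * vi = 1.

Lemma zpowN k : zpow k * zpow (- k) = 1.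
Proof.
have H n : v ^+ n * vi ^+ n = 1 by rewrite -exprMn v_unit expr1n.
case: k => [[|n]|n]; first by rewrite mulr1.
  exact: H.
by rewrite mulrC; exact: H.
Qed.

Lemma right_mul_sq s F w : class_fun F ->
  right_mul s (right_mul s F) w = F w + hecke_param s * right_mul s F w.
Proof.
move=> HF; have wss : cox_eq M ((w ++ [:: s]) ++ [:: s]) w.
  by rewrite -catA -[X in cox_eq M _ X]cats0; exact: (cox_catl w (cox_sq M s)).
have n : cox_len M (w ++ [:: s]) != cox_len M w.
  by rewrite cox_len_rcons -(cox_len_rev M w) cox_len_cons_neq.
rewrite /right_mul (cox_len_eq wss) (HF _ _ wss).
by case: ltngtP n => //= _ _; ring.
Qed.

(** If [t w] and [w s] differ, neither multiplication affects the descent test of the other. If they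
    agree, [s] and [t] are conjugate, and the weight function gives them the same parameter. *)
Lemma left_right_mul s t F : class_fun F ->
  left_mul t (right_mul s F) = right_mul s (left_mul t F).
Proof.
move=> HF; apply: funext => w; rewrite /left_mul /right_mul cat_cons.
have [E|nE] := pselect (cox_eq M (t :: w) (w ++ [:: s])); last first.
  rewrite (left_descent_stable HM Hc nE) (right_descent_stable HM Hc nE).
  by case: ifP => _; case: ifP => _; ring.
have ww : cox_eq M (t :: w ++ [:: s]) w.
  by apply: cox_trans (cox_cons t (cox_sym E)) _; exact: cox_sq_cons.
rewrite (cox_len_eq ww) -(cox_len_eq E) -(HF _ _ E).
have -> : hecke_param t = hecke_param s.
  rewrite /hecke_param (HL (s := s) (s' := t)) //; exists w.
  rewrite -cat_rcons -cats1; apply: cox_trans (cox_catr _ (cox_sym E)) _.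
  exact: (cox_cons t (cox_revr M w)).
by case: ltngtP (cox_len_cons_neq M t w) => //= _ _; ring.
Qed.

Lemma foldr_right_mul_reduced w F p :
  cox_len M (p ++ w) = size (p ++ w) -> foldr right_mul F w p = F (p ++ w).
Proof.
elim: w p => [|s w IHw] p /=; first by rewrite cats0.
rewrite -cat_rcons -cats1 => red; rewrite /right_mul IHw //.
case: ifP; last by rewrite addr0.
have := cox_len_cat M (rev w) (rev (p ++ [:: s])).
rewrite -rev_cat cox_len_rev red cox_len_rev size_rev !size_cat.
by have := cox_len_le_size M p; rewrite /=; lia.
Qed.

Lemma left_mul_foldr t w F : class_fun F ->
  left_mul t (foldr right_mul F w) = foldr right_mul (left_mul t F) w.
Proof.
move=> HF; elim: w => //= s w <-; apply: left_right_mul.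
by elim: w => //= {}s w; exact: right_mul_class.
Qed.

(* Both sides agree at the empty word, and an operator commuting with left multiplications is
   determined by its values there. *)
Lemma right_mul_braid s t m F : class_fun F -> s != t -> M s t = Some m ->
  foldr right_mul F (alt_word s t m) = foldr right_mul F (alt_word t s m).
Proof.
move=> HF st Mst; apply: funext => p; elim: p F HF => [|r p IHp] F HF.
  rewrite !foldr_right_mul_reduced ?cat0s; first by apply: HF; exact: cox_braid.
    rewrite size_alt_word (alt_word_reduced HM Hc) //; first by rewrite eq_sym.
    by case: HM => -> _; rewrite Mst.
  by rewrite size_alt_word (alt_word_reduced HM Hc) // Mst.
have HG := left_mul_class r HF; have := IHp _ HG.
by rewrite -!left_mul_foldr // /left_mul IHp //; case: ifP => _ /addIr.
Qed.

Theorem hecke_act_sound x y : hecke_eq M L x y ->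
  forall F, class_fun F -> hecke_act x F = hecke_act y F.
Proof.
elim=> {x y} /=.
- move=> _ _ [s|s t m st Mst] F HF; last first.
    by rewrite !hecke_act_gens; exact: right_mul_braid.
  apply: funext => w; rewrite /= !hecke_act_vpow.
  have -> : (fun w => right_mul s F w + zpow (- L s) * F w) =
            (fun w => 1 * right_mul s F w + zpow (- L s) * F w).
    by apply: funext => u; rewrite mul1r.
  have := hecke_act_linear (TGen s) (right_mul s F) F 1 (zpow (- L s)).
  rewrite /= => ->; rewrite right_mul_sq // /hecke_param.
  have := zpowN (L s); move: (zpow (L s)) (zpow (- L s)) (right_mul _ _ _) => a b g ab.
  by transitivity ((1 - a * b) * F w); [ring | rewrite ab subrr mul0r].
- by [].
- by move=> x y _ IH F /IH ->.
- by move=> x y z _ IH1 _ IH2 F HF; rewrite IH1 // IH2.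
- by move=> x x' y y' _ IH1 _ IH2 F HF; rewrite IH1 // IH2.
- by move=> x x' _ IH F HF; rewrite IH.
- move=> x x' y y' _ IH1 _ IH2 F HF; rewrite IH2 // IH1 //.
  exact: hecke_act_class.
- by move=> x y z F _; apply: funext => w; rewrite addrA.
- by move=> x y F _; apply: funext => w; rewrite addrC.
- by move=> x F _; apply: funext => w; rewrite add0r.
- by move=> x F _; apply: funext => w; rewrite subrr.
- by [].
- by [].
- by [].
- by [].
- move=> x y z F _; have := hecke_act_linear x (hecke_act y F) (hecke_act z F) 1 1.
  have -> : (fun w => 1 * hecke_act y F w + 1 * hecke_act z F w) =
            (fun w => hecke_act y F w + hecke_act z F w).
    by apply: funext => u; rewrite !mul1r.
  by move=> ->; apply: funext => u; rewrite !mul1r.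
- by move=> F _; apply: funext => w; rewrite mulrA v_unit mul1r.
- by move=> F _; apply: funext => w; rewrite mulrA [vi * v]mulrC v_unit mul1r.
- move=> x F _; have := hecke_act_linear x F F v 0.
  have -> : (fun w => v * F w + 0 * F w) = (fun w => v * F w).
    by apply: funext => u; rewrite mul0r addr0.
  by move=> ->; apply: funext => u; rewrite mul0r addr0.
Qed.

End HeckeModule.

(** * Rings presented by terms *)

HB.instance Definition _ (S : Type) := gen_eqMixin (term S).
HB.instance Definition _ (S : Type) := gen_choiceMixin (term S).

Section PresentedAlgebra.
Local Open Scope ring_scope.
Local Open Scope quotient_scope.
Variables (S : Type) (P : term S -> term S -> Prop).

Definition alg_eqb (x y : term S) : bool := `[< alg_eq P x y >].

Lemma alg_eqb_refl : reflexive alg_eqb.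
Proof. by move=> x; apply/asboolP; exact: ae_refl. Qed.

Lemma alg_eqb_sym : symmetric alg_eqb.
Proof. by move=> x y; apply/asboolP/asboolP => ?; exact: ae_sym. Qed.

Lemma alg_eqb_trans : transitive alg_eqb.
Proof.
by move=> y x z /asboolP xy /asboolP yz; apply/asboolP; exact: (ae_trans xy yz).
Qed.

Canonical alg_equiv := EquivRel alg_eqb alg_eqb_refl alg_eqb_sym alg_eqb_trans.

Definition presented := {eq_quot alg_equiv}.

HB.instance Definition _ := Choice.on presented.
HB.instance Definition _ := EqQuotient.on presented.

Definition cls (x : term S) : presented := \pi_presented x.

Lemma clsP x y : cls x = cls y <-> alg_eq P x y.
Proof.
split=> [/eqP|xy]; last by apply/eqP; rewrite /cls eqmodE; apply/asboolP.
by rewrite /cls eqmodE => /asboolP.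
Qed.

Lemma cls_repr (a : presented) : cls (repr a) = a.
Proof. exact: reprK. Qed.

Lemma repr_cls x : alg_eq P (repr (cls x)) x.
Proof. by apply/clsP; rewrite cls_repr. Qed.

Definition padd (a b : presented) : presented := cls (TAdd (repr a) (repr b)).
Definition popp (a : presented) : presented := cls (TOpp (repr a)).
Definition pmul (a b : presented) : presented := cls (TMul (repr a) (repr b)).

Lemma padd_cls x y : padd (cls x) (cls y) = cls (TAdd x y).
Proof. by apply/clsP; apply: ae_add; exact: repr_cls. Qed.
Lemma popp_cls x : popp (cls x) = cls (TOpp x).
Proof. by apply/clsP; apply: ae_opp; exact: repr_cls. Qed.
Lemma pmul_cls x y : pmul (cls x) (cls y) = cls (TMul x y).
Proof. by apply/clsP; apply: ae_mul; exact: repr_cls. Qed.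

Let opE := (padd_cls, popp_cls, pmul_cls).

Lemma paddA : associative padd.
Proof.
move=> a b d; rewrite -(cls_repr a) -(cls_repr b) -(cls_repr d) !opE.
apply/clsP; exact: ae_addA.
Qed.
Lemma paddC : commutative padd.
Proof.
move=> a b; rewrite -(cls_repr a) -(cls_repr b) !opE; apply/clsP; exact: ae_addC.
Qed.
Lemma padd0 : left_id (cls T0) padd.
Proof. by move=> a; rewrite -(cls_repr a) !opE; apply/clsP; exact: ae_add0. Qed.
Lemma paddN : left_inverse (cls T0) popp padd.
Proof.
by move=> a; rewrite paddC -(cls_repr a) !opE; apply/clsP; exact: ae_addN.
Qed.

HB.instance Definition _ := GRing.isZmodule.Build presented paddA paddC padd0 paddN.

Lemma pmulA : associative pmul.
Proof.
move=> a b d; rewrite -(cls_repr a) -(cls_repr b) -(cls_repr d) !opE.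
apply/clsP; exact: ae_mulA.
Qed.
Lemma pmul1l : left_id (cls T1) pmul.
Proof. by move=> a; rewrite -(cls_repr a) !opE; apply/clsP; exact: ae_mul1l. Qed.
Lemma pmul1r : right_id (cls T1) pmul.
Proof. by move=> a; rewrite -(cls_repr a) !opE; apply/clsP; exact: ae_mul1r. Qed.
Lemma pmulDl : left_distributive pmul padd.
Proof.
move=> a b d; rewrite -(cls_repr a) -(cls_repr b) -(cls_repr d) !opE.
apply/clsP; exact: ae_mulDl.
Qed.
Lemma pmulDr : right_distributive pmul padd.
Proof.
move=> a b d; rewrite -(cls_repr a) -(cls_repr b) -(cls_repr d) !opE.
apply/clsP; exact: ae_mulDr.
Qed.

HB.instance Definition _ :=
  GRing.Zmodule_isPzRing.Build presented pmulA pmul1l pmul1r pmulDl pmulDr.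

Lemma cls0 : cls T0 = 0. Proof. by []. Qed.
Lemma cls1 : cls T1 = 1. Proof. by []. Qed.
Lemma clsD x y : cls (TAdd x y) = cls x + cls y. Proof. by rewrite -padd_cls. Qed.
Lemma clsN x : cls (TOpp x) = - cls x. Proof. by rewrite -popp_cls. Qed.
Lemma clsM x y : cls (TMul x y) = cls x * cls y. Proof. by rewrite -pmul_cls. Qed.
Lemma clsB x y : cls (TSub x y) = cls x - cls y. Proof. by rewrite clsD clsN. Qed.

Definition clsE := (cls0, cls1, clsB, clsD, clsN, clsM).

Lemma cls_VVi : cls TV * cls TVi = 1.
Proof. by rewrite -clsM -cls1; apply/clsP; exact: ae_VVi. Qed.

Lemma cls_ViV : cls TVi * cls TV = 1.
Proof. by rewrite -clsM -cls1; apply/clsP; exact: ae_ViV. Qed.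

Lemma cls_Vcentral a : cls TV * a = a * cls TV.
Proof. by rewrite -(cls_repr a) -!clsM; apply/clsP; exact: ae_Vcentral. Qed.

Lemma cls_Vicentral a : cls TVi * a = a * cls TVi.
Proof.
rewrite -[LHS]mulr1 -cls_VVi mulrA -[cls TVi * a * _]mulrA -cls_Vcentral !mulrA.
by rewrite cls_ViV mul1r.
Qed.

Lemma cls_prod l : cls (tprod l) = \prod_(x <- l) cls x.
Proof. by elim: l => [|x l IHl]; rewrite ?big_nil // big_cons -IHl /= clsM. Qed.

Definition vz (k : int) : presented := cls (vpow S k).

Lemma vzS k : cls TV * vz k = vz (k + 1).
Proof.
case: k => [n|[|n]].
- by rewrite -PoszD addn1 /vz -clsM.
- by rewrite /vz /= !clsE mulrA cls_VVi mul1r.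
- have -> : Negz n.+1 + 1 = Negz n by rewrite !NegzE; lia.
  by rewrite /vz [vpow S (Negz n.+1)]/= clsM mulrA cls_VVi mul1r.
Qed.

Lemma vzP k : cls TVi * vz k = vz (k - 1).
Proof. by rewrite -{1}(subrK 1 k) -vzS mulrA cls_ViV mul1r. Qed.

Lemma vz0 : vz 0 = 1. Proof. by []. Qed.

Lemma vzD j k : vz (j + k) = vz j * vz k.
Proof.
elim/int_ind: j => [|n IHn|n IHn]; first by rewrite add0r mul1r.
  by rewrite -addn1 PoszD -vzS -mulrA -IHn vzS; congr vz; ring.
have -> : - n.+1%:Z = - n%:Z - 1 by lia.
by rewrite -vzP -mulrA -IHn vzP; congr vz; ring.
Qed.

Lemma vz_central k a : vz k * a = a * vz k.
Proof.
elim/int_ind: k => [|n IHn|n IHn]; first by rewrite mul1r mulr1.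
  by rewrite -addn1 PoszD -vzS -mulrA IHn mulrA cls_Vcentral mulrA.
have -> : - n.+1%:Z = - n%:Z - 1 by lia.
by rewrite -vzP -mulrA IHn mulrA cls_Vicentral mulrA.
Qed.

Lemma vzX (n : nat) : vz n = cls TV ^+ n.
Proof. by elim: n => [//|n IHn]; rewrite exprS -IHn vzS -PoszD addn1. Qed.

End PresentedAlgebra.

(** * Spanning the Hecke algebra by canonical words *)

Section HeckeSpan.
Local Open Scope ring_scope.
Variables (S : eqType) (M : coxmat S) (L : S -> int).
Local Notation H := (presented (hecke_rel M L)).
Local Notation "u ~ w" := (cox_eq M u w) (at level 70).
Local Notation len := (cox_len M).

Definition gen (s : S) : H := cls (hecke_rel M L) (TGen s).
Local Notation vH := (vz (hecke_rel M L)).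

Lemma gen_quad s : gen s * gen s = 1 + (vH (L s) - vH (- L s)) * gen s.
Proof.
have : (gen s - vH (L s)) * (gen s + vH (- L s)) = 0.
  rewrite /gen /vz -clsD -clsB -clsM -cls0; apply/clsP; apply: ae_rel.
  exact: hr_quad.
rewrite mulrBl !mulrDr -vzD subrr vz0 -vz_central => /eqP.
rewrite subr_eq0 => /eqP e; rewrite mulrBl addrA; apply: (canRL (addrK _)).
by rewrite e addrC.
Qed.

Definition gen_inv s : H := gen s - (vH (L s) - vH (- L s)).

Lemma gen_mulV s : gen s * gen_inv s = 1.
Proof.
rewrite /gen_inv mulrBr gen_quad mulrBl mulrBr -!(vz_central _ (gen s)).
by rewrite addrK.
Qed.

Lemma gen_Vmul s : gen_inv s * gen s = 1.
Proof. by rewrite /gen_inv mulrBl gen_quad addrK. Qed.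

Lemma cls_gens w :
  cls (hecke_rel M L) (tprod (map (@TGen S) w)) = \prod_(s <- w) gen s.
Proof. by rewrite cls_prod big_map. Qed.

Lemma gen_braid s t m : s != t -> M s t = Some m ->
  \prod_(x <- alt_word s t m) gen x = \prod_(x <- alt_word t s m) gen x.
Proof.
by move=> st Mst; rewrite -!cls_gens; apply/clsP; apply: ae_rel; exact: hr_braid.
Qed.

(** A chosen reduced word. Equivalent words define the same predicate, hence get the same choice, so
    that these words index the group elements without a quotient. *)
Definition canonical_word (w : seq S) : seq S :=
  epsilon (inhabits [::]) (fun u => w ~ u /\ size u = len w).

Lemma canonical_wordP w : w ~ canonical_word w /\ size (canonical_word w) = len w.
Proof.
apply: (epsilon_spec (inhabits [::]) (fun u => w ~ u /\ size u = len w)).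
by have [u wu su] := cox_len_min M w; exists u.
Qed.

Lemma canonical_word_eq u w : u ~ w -> canonical_word u = canonical_word w.
Proof.
move=> uw; rewrite /canonical_word; congr epsilon; apply: funext => x.
rewrite (cox_len_eq uw); apply: propext; split=> -[ux sx]; split=> //.
  exact: cox_trans (cox_sym uw) ux.
exact: cox_trans uw ux.
Qed.

Lemma canonical_word_idem w : canonical_word (canonical_word w) = canonical_word w.
Proof. by apply/esym/canonical_word_eq; case: (canonical_wordP w). Qed.

Lemma canonical_word_reduced w : len (canonical_word w) = size (canonical_word w).
Proof.
by have [wc ->] := canonical_wordP w; apply/esym/cox_len_eq.
Qed.

(** A sign, an exponent of [v] and a word. Integer coefficients arise by repetition, so the Laurent
    polynomials need not be built here. *)
Definition monomial : Type := (bool * int * seq S)%type.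

Definition monomial_term (k : monomial) : term S :=
  let x := TMul (vpow S k.1.2) (tprod (map (@TGen S) k.2)) in
  if k.1.1 then TOpp x else x.

Definition comb_term (l : seq monomial) : term S :=
  foldr (fun k x => TAdd (monomial_term k) x) T0 l.

Definition monomial_val (k : monomial) : H :=
  (-1) ^+ k.1.1 * (vH k.1.2 * \prod_(s <- k.2) gen s).

Lemma cls_comb_term l :
  cls (hecke_rel M L) (comb_term l) = \sum_(k <- l) monomial_val k.
Proof.
elim: l => [|[[b j] w] l IHl]; first by rewrite big_nil.
rewrite big_cons -IHl /= clsD; congr (_ + _).
rewrite /monomial_term /monomial_val /=; case: b => /=.
  by rewrite clsN clsM cls_gens expr1 mulN1r.
by rewrite clsM cls_gens expr0 mul1r.
Qed.

Definition spanned (a : H) : Prop :=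
  exists2 l : seq monomial, all (fun k => canonical_word k.2 == k.2) l
    & a = \sum_(k <- l) monomial_val k.

Lemma spanned0 : spanned 0.
Proof. by exists [::] => //; rewrite big_nil. Qed.

Lemma spannedD a b : spanned a -> spanned b -> spanned (a + b).
Proof.
by move=> [l l1 ->] [l' l2 ->]; exists (l ++ l'); rewrite ?all_cat ?l1 // big_cat.
Qed.

Lemma spannedN a : spanned a -> spanned (- a).
Proof.
move=> [l l1 ->]; exists [seq (~~ k.1.1, k.1.2, k.2) | k <- l].
  by rewrite all_map; apply: sub_all l1.
rewrite big_map -sumrN; apply: eq_bigr => -[[b j] w] _.
by rewrite /monomial_val /=; case: b; rewrite /= ?expr0 ?expr1 !mulN1r ?mul1r ?opprK.
Qed.

Lemma spanned_vz j a : spanned a -> spanned (vH j * a).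
Proof.
move=> [l l1 ->]; exists [seq (k.1.1, j + k.1.2, k.2) | k <- l].
  by rewrite all_map; apply: sub_all l1.
rewrite big_map mulr_sumr; apply: eq_bigr => -[[b i] w] _.
by rewrite /monomial_val /= vzD [LHS]mulrA (vz_central _ (_ ^+ _)) -!mulrA.
Qed.

Variable c : S -> S -> R.
Hypotheses (HM : is_coxeter_matrix M) (Hc : coxeter_form M c).

Lemma spanned_reduced w : len w = size w -> spanned (\prod_(s <- w) gen s).
Proof.
move=> redw; exists [:: (false, 0, canonical_word w)].
  by rewrite /= canonical_word_idem eqxx.
rewrite big_seq1 /monomial_val /= expr0 mul1r vz0 mul1r.
apply: (matsumoto HM Hc gen_braid redw (canonical_word_reduced w)).
by case: (canonical_wordP w).
Qed.

Lemma spanned_gen_word s w : canonical_word w = w ->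
  spanned (gen s * \prod_(x <- w) gen x).
Proof.
move=> cw; have redw := canonical_word_reduced w; rewrite cw in redw.
case: (cox_len_cons M s w) => lsw.
  have -> : gen s * \prod_(x <- w) gen x = \prod_(x <- s :: w) gen x by rewrite big_cons.
  by apply: spanned_reduced; rewrite lsw redw.
(* Here [s] shortens [w]: Matsumoto's theorem rewrites the product over [w] to start with [gen s],
   and the quadratic relation applies. *)
have [sx lx] := canonical_wordP (s :: w); have redx := canonical_word_reduced (s :: w).
move: (canonical_word _) sx lx redx => x sx lx redx.
have wx : w ~ s :: x.
  by apply: cox_trans (cox_sym (cox_sq_cons M s w)) _; exact: cox_cons.
have redsx : len (s :: x) = size (s :: x) by rewrite -(cox_len_eq wx) lsw /= lx.
have E : \prod_(y <- w) gen y = gen s * \prod_(y <- x) gen y.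
  by rewrite (matsumoto HM Hc gen_braid redw redsx wx) big_cons.
rewrite {1}E mulrA gen_quad mulrDl mul1r -mulrA -E mulrBl.
have sw : spanned (\prod_(y <- w) gen y) := spanned_reduced redw.
apply: spannedD; first exact: spanned_reduced.
by apply: spannedD; [|apply: spannedN]; exact: spanned_vz.
Qed.

Lemma spanned_gen s a : spanned a -> spanned (gen s * a).
Proof.
move=> [l l1 ->]; elim: l l1 => [|[[b j] w] l IHl] /=.
  by rewrite big_nil mulr0 => _; exact: spanned0.
case/andP=> /eqP cw /IHl sl; rewrite big_cons mulrDr; apply: spannedD => //.
rewrite /monomial_val /=.
have : spanned (vH j * (gen s * \prod_(x <- w) gen x)).
  by apply: spanned_vz; exact: spanned_gen_word.
rewrite mulrA vz_central -mulrA => sj.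
by case: b => /=; rewrite ?expr1 ?expr0 ?mul1r // mulN1r mulrN; apply: spannedN.
Qed.

Theorem hecke_spanned x : spanned (cls (hecke_rel M L) x).
Proof.
suff H y : spanned y -> spanned (cls (hecke_rel M L) x * y).
  rewrite -[cls _ x]mulr1; apply: H.
  have -> : 1 = \prod_(s <- [::]) gen s by rewrite big_nil.
  by apply: spanned_reduced; apply/eqP; rewrite -leqn0 (cox_len_le_size M [::]).
elim: x y => [|||||a IHa b IHb|a IHa|a IHa b IHb] => [||||s|||] y sy; rewrite ?clsE.
- by rewrite mul0r; exact: spanned0.
- by rewrite mul1r.
- by rewrite -[cls _ TV]mulr1 -clsE -clsM; exact: (spanned_vz 1 sy).
- by rewrite -[cls _ TVi]mulr1 -clsE -clsM; exact: (spanned_vz (-1) sy).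
- exact: spanned_gen.
- by rewrite mulrDl; apply: spannedD; [exact: IHa | exact: IHb].
- by rewrite mulNr; apply: spannedN; exact: IHa.
- by rewrite -mulrA; exact/IHa/IHb.
Qed.

End HeckeSpan.

(** * Edge contraction *)

Definition standard_form (S : eqType) (M : coxmat S) (s t : S) : R :=
  if s == t then (-2)%R
  else if M s t is Some m then (2 * cos (PI / INR m))%R else 2%R.

Lemma standard_formP (S : eqType) (M : coxmat S) :
  is_coxeter_matrix M -> coxeter_form M (standard_form M).
Proof.
move=> [Msym [M1 _]]; rewrite /standard_form; split=> [s|s t|s t m st ->|s t E].
- by rewrite eqxx.
- by rewrite eq_sym Msym.
- by rewrite (negbTE st).
- case: eqP => [e|_]; last by rewrite E; lra.
  by move/M1: e; rewrite E.
Qed.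

Section Contraction.
Variables (S : eqType) (M : coxmat S) (sp sm : S).
Hypotheses (HM : is_coxeter_matrix M) (spm : sp != sm) (M3 : M sp sm = Some 3).
Local Notation S' := (contr_type sp sm).
Local Notation N := (contr_mat M sp sm).

Lemma contr_val_neq (a : {s : S | (s != sp) && (s != sm)}) :
  (val a != sp) /\ (val a != sm).
Proof. by apply/andP; exact: (valP a). Qed.

(** One of the two entries is 2, and subtracting 2 from the sum leaves the other. *)
Lemma contr_edge_valP a m : contr_edge_val M sp sm a = Some m ->
  (M a sm = Some 2 /\ M a sp = Some m) \/ (M a sp = Some 2 /\ M a sm = Some m).
Proof.
rewrite /contr_edge_val; case: (M a sp) => [p|]; case: (M a sm) => [q|] /=; last 3 first.
- by case: ifP.
- by case: ifP.
- by [].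
by case: ifP => // /orP[] /eqP [->] [<-]; [right; rewrite addKn|left; rewrite addnK].
Qed.

Lemma contr_coxeter : is_coxeter_matrix N.
Proof.
case: (HM) => Msym [M1 M0]; split=> [[a|] [b|] //=|]; split=> [[a|] [b|]|[a|] [b|]] //=.
- rewrite M1; split=> [/val_inj -> //|[->] //].
- have [/negP ap /negP am] := contr_val_neq a.
  by split=> // /contr_edge_valP [] [_ /M1/eqP]; [move/ap | move/am].
- have [/negP ap /negP am] := contr_val_neq b.
  by split=> // /contr_edge_valP [] [_ /M1/eqP]; [move/ap | move/am].
- by case/contr_edge_valP => [[_ /M0]|[_ /M0]].
- by case/contr_edge_valP => [[_ /M0]|[_ /M0]].
Qed.

Local Notation c := (standard_form M).

(** The form of [M] with [a_sp + a_sm] as the root of [s0]; its norm is [-2 - 2 + 2 * 1], as the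
    entry 3 gives the value 1. *)
Definition contr_form (x y : S') : R :=
  match x, y with
  | None, None => (-2)%R
  | Some a, Some b => c (val a) (val b)
  | Some a, None | None, Some a => (c (val a) sp + c (val a) sm)%R
  end.

Lemma standard_form2 s t : s != t -> M s t = Some 2 -> c s t = 0%R.
Proof.
move=> st E; rewrite /standard_form (negbTE st) E.
have -> : INR 2 = 2%R by [].
by rewrite cos_PI2; lra.
Qed.

Lemma standard_form_ge1 s t : s != t -> M s t != Some 2 -> (1 <= c s t)%R.
Proof.
move=> st; rewrite /standard_form (negbTE st); case E: (M s t) => [m|] m2; last by lra.
have m1 := coxeter_matrix_gt1 HM st E; apply: (cos_order_ge1 m1).
by case: m m1 m2 {E} => [|[|[|m]]].
Qed.

Lemma standard_form_edge : c sp sm = 1%R.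
Proof.
rewrite /standard_form (negbTE spm) M3.
have -> : INR 3 = 3%R by rewrite /=; lra.
by rewrite cos_PI3; lra.
Qed.

(** If both entries at the edge exceed 2, each summand is at least 1, so the sum reaches the bound 2
    of an infinite entry. Otherwise one summand vanishes and the other belongs to the entry that the
    contraction keeps. *)
Lemma contr_formP : coxeter_form N contr_form.
Proof.
have [Hd Hs Hf Hinf] := standard_formP HM.
have fin a m : contr_edge_val M sp sm (val a) = Some m ->
    contr_form (Some a) None = (2 * cos (PI / INR m))%R.
  have [ap am] := contr_val_neq a => /=.
  by case/contr_edge_valP => -[E /Hf ->] //; rewrite standard_form2 //; lra.
have inf a : contr_edge_val M sp sm (val a) = None -> (2 <= contr_form (Some a) None)%R.
  have [ap am] := contr_val_neq a => /=; rewrite /contr_edge_val.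
  case: (boolP (M (val a) sp == Some 2)) => [/eqP E|Ep].
    rewrite E (standard_form2 ap E) /=; case Em: (M (val a) sm) => [//|] _.
    by have /= := Hinf _ _ Em; lra.
  case: (boolP (M (val a) sm == Some 2)) => [/eqP E|Em].
    rewrite E (standard_form2 am E) /=; case Eq: (M (val a) sp) => [//|] _.
    by have /= := Hinf _ _ Eq; lra.
  by have /= := standard_form_ge1 ap Ep; have /= := standard_form_ge1 am Em; lra.
split=> [[a|]|[a|] [b|]|[a|] [b|] m|[a|] [b|]] //.
- exact: Hd.
- exact: Hs.
- by move=> ab E; apply: Hf => //; apply: contra ab => /eqP /val_inj ->.
- by move=> _; exact: fin.
- by move=> _; exact: fin.
- exact: Hinf.
- exact: inf.
- exact: inf.
Qed.

Definition contr_gen_word (x : S') : seq S :=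
  if x is Some a then [:: val a] else [:: sp; sm; sp].

Definition contr_word (w : seq S') : seq S := flatten (map contr_gen_word w).

(* The new simple root is [a_sp + a_sm]. *)
Definition contr_res (f : S -> R) (x : S') : R :=
  if x is Some a then f (val a) else (f sp + f sm)%R.

(** [sp] maps the root of [sm] to [a_sp + a_sm], so [sp sm sp] is the reflection in this root. *)
Lemma contr_res_act w f :
  contr_res (word_act c (contr_word w) f) = word_act contr_form w (contr_res f).
Proof.
have [Hd Hs _ _] := standard_formP HM; have ce := standard_form_edge.
elim: w => [//|x w IHw]; rewrite /contr_word /= act_cat word_act_cons -IHw.
move: (word_act c _ f) => g; apply: funext => y.
case: x => [a|]; case: y => [b|];
  rewrite /= !word_act_cons /word_act /= /refl_act /= ?Hd ?ce ?(Hs sm sp) ?ce.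
- by [].
- by lra.
- by rewrite (Hs sp (sval b)) (Hs sm (sval b)); lra.
- by lra.
Qed.

Theorem contr_word_inj u w :
  cox_eq M (contr_word u) (contr_word w) -> cox_eq N u w.
Proof.
move=> uw; pose one : S -> R := fun=> 1%R.
apply: (act_faithful contr_coxeter contr_formP (f := contr_res one)).
  by case=> [a|]; rewrite /= /one; lra.
by rewrite -!contr_res_act (act_cox_eq HM (standard_formP HM) uw).
Qed.

End Contraction.

(** * Compatibility of [phi_v] with the Hecke relations *)

Section PhiWellDefined.
Local Open Scope ring_scope.
Variables (S : eqType) (M : coxmat S) (L : S -> int) (sp sm : S).
Hypotheses (HM : is_coxeter_matrix M) (HL : is_weight M L).
Hypotheses (spm : sp != sm) (M3 : M sp sm = Some 3%N).
Local Notation S' := (contr_type sp sm).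
Local Notation N := (contr_mat M sp sm).
Local Notation H := (presented (hecke_rel M L)).
Local Notation clsH := (cls (hecke_rel M L)).
Local Notation vH := (vz (hecke_rel M L)).
Local Notation T := (gen M L).

(** The image of [T'_{s0}] is a conjugate of [T_sm], while its weight is defined as that of [sp];
    the quadratic relation needs the two to agree. *)
Lemma weight_edge : L sp = L sm.
Proof.
apply: HL; exists [:: sp; sm].
have b : cox_eq M [:: sp; sm; sp] [:: sm; sp; sm] := cox_braid spm M3.
apply: cox_trans (cox_catr [:: sm; sp] b) _.
apply: cox_trans (cox_catl [:: sm; sp] (cox_sq_cons M sm [:: sp])) _.
exact: (cox_catl [:: sm] (cox_sq M sp)).
Qed.

Lemma phi_vpow k : phi_v L (vpow S' k) = vpow S k.
Proof.
by case: k => n /=; [|congr TMul]; elim: n => //= n ->.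
Qed.

Definition phi_gen (x : S') : H := clsH (phi_v L (TGen x)).

Lemma phi_gen_edge : phi_gen None = T sp * T sm * gen_inv M L sp.
Proof. by rewrite /phi_gen /= !clsM clsB clsB. Qed.

Lemma gen_braid3 : T sp * T sm * T sp = T sm * T sp * T sm.
Proof.
have := gen_braid L spm M3.
by rewrite /alt_word /= !big_cons !big_nil !mulr1 !mulrA.
Qed.

(** For a vertex that commutes with [sm], its generator is fixed by this conjugation, which carries
    its braid relation with [T sp] over to [phi_gen None]. The defining expression does the same for
    a vertex that commutes with [sp]. *)
Lemma phi_gen_edge' : phi_gen None = gen_inv M L sm * T sp * T sm.
Proof.
rewrite phi_gen_edge -[T sp in LHS]mul1r -(gen_Vmul M L sm).
rewrite -[gen_inv M L sm * T sm * T sp * T sm]mulrA -[gen_inv M L sm * T sm * _]mulrA.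
rewrite [T sm * (T sp * T sm)]mulrA -gen_braid3 -!mulrA gen_mulV mulr1.
by [].
Qed.

Lemma conj_prod (g gi : H) (w : seq H) : g * gi = 1 -> gi * g = 1 ->
  \prod_(x <- map (fun x => g * x * gi) w) x = g * \prod_(x <- w) x * gi.
Proof.
move=> ggi gig; elim: w => [|x w IHw]; first by rewrite !big_nil mulr1.
by rewrite /= !big_cons IHw -!mulrA (mulrA gi) gig mul1r.
Qed.

Lemma conj_braid (g gi a b : H) m : g * gi = 1 -> gi * g = 1 -> g * a = a * g ->
  \prod_(x <- alt_word a b m) x = \prod_(x <- alt_word b a m) x ->
  \prod_(x <- alt_word a (g * b * gi) m) x = \prod_(x <- alt_word (g * b * gi) a m) x.
Proof.
move=> ggi gig ga ab; have aE : a = g * a * gi by rewrite ga -mulrA ggi mulr1.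
rewrite {1 2}aE -[in LHS](alt_word_map (fun x => g * x * gi)).
by rewrite -(alt_word_map (fun x => g * x * gi)) !conj_prod // ab.
Qed.

Lemma gen_comm s t : s != t -> M s t = Some 2%N -> T s * T t = T t * T s.
Proof.
by move=> st E; have := gen_braid L st E;
  rewrite /alt_word /= !big_cons !big_nil !mulr1.
Qed.

Lemma gen_inv_comm s t : s != t -> M s t = Some 2%N ->
  gen_inv M L t * T s = T s * gen_inv M L t.
Proof.
move=> st E; rewrite -[RHS]mul1r -{1}(gen_Vmul M L t) -!mulrA; congr (_ * _).
by rewrite mulrA -gen_comm // -mulrA gen_mulV mulr1.
Qed.

Lemma phi_gen_edge_braid a m : contr_edge_val M sp sm (val a) = Some m ->
  \prod_(x <- alt_word (phi_gen (Some a)) (phi_gen None) m) x =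
  \prod_(x <- alt_word (phi_gen None) (phi_gen (Some a)) m) x.
Proof.
have [ap am] := contr_val_neq a.
have alt s t : s != t -> M s t = Some m ->
    \prod_(x <- alt_word (T s) (T t) m) x = \prod_(x <- alt_word (T t) (T s) m) x.
  by move=> st /(gen_braid L st); rewrite -!(alt_word_map T) !big_map.
case/contr_edge_valP => -[E2 Em].
  rewrite phi_gen_edge'; apply: conj_braid.
  - exact: gen_Vmul.
  - exact: gen_mulV.
  - exact: gen_inv_comm.
  - exact: alt.
rewrite phi_gen_edge; apply: conj_braid.
- exact: gen_mulV.
- exact: gen_Vmul.
- exact/esym/gen_comm.
- exact: alt.
Qed.

Lemma phi_quad x :
  (phi_gen x - vH (contr_weight L sp sm x)) *
  (phi_gen x + vH (- contr_weight L sp sm x)) = 0.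
Proof.
have quad s : (T s - vH (L s)) * (T s + vH (- L s)) = 0.
  rewrite /gen /vz -clsD -clsB -clsM -cls0; apply/clsP; apply: ae_rel.
  exact: hr_quad.
case: x => [a|]; first exact: quad.
have cj b : b * T sp = T sp * b -> b = T sp * b * gen_inv M L sp.
  by move=> <-; rewrite -mulrA gen_mulV mulr1.
rewrite phi_gen_edge /= weight_edge (cj (vH (L sm))) ?vz_central //.
rewrite (cj (vH (- L sm))) ?vz_central // -mulrBl -mulrBr -mulrDl -mulrDr.
rewrite -!mulrA (mulrA (gen_inv M L sp)) gen_Vmul mul1r (mulrA (T sm - _)) quad.
by rewrite mul0r mulr0.
Qed.

Lemma cls_phi_gens w :
  clsH (phi_v L (tprod (map (@TGen S') w))) = \prod_(x <- map phi_gen w) x.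
Proof.
elim: w => [|x w IHw]; first by rewrite big_nil.
by rewrite big_cons -IHw -clsM.
Qed.

(** As [phi_v] acts on terms, this is what allows an element of the kernel to be replaced by its
    expansion in canonical words. *)
Theorem phi_well_defined x y :
  hecke_eq N (contr_weight L sp sm) x y -> hecke_eq M L (phi_v L x) (phi_v L y).
Proof.
elim=> {x y}; try by move=> *; constructor.
- move=> _ _ [s|s t m st Nst]; apply/clsP.
    rewrite /= cls0 -(phi_quad s) clsM clsB clsD !phi_vpow /phi_gen /vz.
    by case: s.
  rewrite !cls_phi_gens !alt_word_map; case: s t st Nst => [a|] [b|] //= st E.
  - have ab : val a != val b by apply: contra st => /eqP /val_inj ->.
    by have := gen_braid L ab E; rewrite -!(big_map T xpredT (fun x => x)) !alt_word_map.
  - exact: phi_gen_edge_braid.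
  - exact/esym/phi_gen_edge_braid.
- by move=> x y z _ xy _; exact: ae_trans.
Qed.

End PhiWellDefined.

(** * Specialization at v = 1 *)

Section GroupSum.
Local Open Scope ring_scope.

Lemma big_group_undup (V : nmodType) (I J : eqType) (l : seq I) (h : I -> J) (f : I -> V) :
  \sum_(k <- l) f k = \sum_(w <- undup (map h l)) \sum_(k <- l | h k == w) f k.
Proof.
rewrite (exchange_big_dep xpredT) //= [LHS]big_seq [RHS]big_seq.
apply: eq_bigr => k kl.
rewrite big_mkcond (bigD1_seq (h k)) ?undup_uniq ?mem_undup ?map_f //= eqxx.
by rewrite big1 ?addr0 // => w; rewrite eq_sym => /negbTE ->.
Qed.

End GroupSum.

Section Laurent.
Local Open Scope ring_scope.
Import fraction.

Local Notation K := {fraction {poly int}}.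
Definition vK : K := tofrac 'X.

Lemma vK_neq0 : vK != 0.
Proof. by rewrite tofrac_eq0 polyX_eq0. Qed.

Lemma vK_unit : vK * vK^-1 = 1.
Proof. exact/mulfV/vK_neq0. Qed.

(* [g] is a Laurent polynomial in [v] whose value at [v = 1] is [n]. *)
Definition laurent_at1 (g : K) (n : int) : Prop :=
  exists N (p : {poly int}), vK ^+ N * g = tofrac p /\ p.[1] = n.

Lemma laurent_poly p : laurent_at1 (tofrac p) p.[1].
Proof. by exists 0%N, p; rewrite expr0 mul1r. Qed.

Lemma laurent_uniq0 n : laurent_at1 0 n -> n = 0.
Proof.
case=> N [p [e <-]]; move/eqP: e; rewrite mulr0 eq_sym tofrac_eq0 => /eqP ->.
by rewrite horner0.
Qed.

Lemma laurent_raise g n : laurent_at1 g n ->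
  exists N, forall N', (N <= N')%N -> exists p, vK ^+ N' * g = tofrac p /\ p.[1] = n.
Proof.
case=> N [p [e pn]]; exists N => N' NN; exists ('X^(N' - N) * p).
rewrite -(subnK NN) exprD -mulrA e addnK tofracM tofracXn; split=> //.
by rewrite hornerM hornerXn expr1n mul1r.
Qed.

Lemma laurentD g h m n : laurent_at1 g m -> laurent_at1 h n -> laurent_at1 (g + h) (m + n).
Proof.
move=> /laurent_raise [N1 H1] /laurent_raise [N2 H2].
have [p [ep <-]] := H1 _ (leq_maxl N1 N2); have [q [eq <-]] := H2 _ (leq_maxr N1 N2).
by exists (maxn N1 N2), (p + q); rewrite mulrDr ep eq tofracD hornerD.
Qed.

Lemma laurentM g h m n : laurent_at1 g m -> laurent_at1 h n -> laurent_at1 (g * h) (m * n).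
Proof.
move=> [N1 [p [ep <-]]] [N2 [q [eq <-]]]; exists (N1 + N2)%N, (p * q).
by rewrite exprD mulrACA ep eq tofracM hornerM.
Qed.

Lemma laurent0 : laurent_at1 0 0.
Proof. by have := laurent_poly 0; rewrite tofrac0 horner0. Qed.

Lemma laurent1 : laurent_at1 1 1.
Proof. by have := laurent_poly 1; rewrite tofrac1 hornerE. Qed.

Lemma laurentN g n : laurent_at1 g n -> laurent_at1 (- g) (- n).
Proof.
case=> N [p [e <-]]; exists N, (- p).
by rewrite mulrN e tofracN hornerN.
Qed.

Lemma laurent_v : laurent_at1 vK 1.
Proof. by have := laurent_poly 'X; rewrite hornerX. Qed.

Lemma laurent_vi : laurent_at1 vK^-1 1.
Proof. by exists 1%N, 1; rewrite expr1 vK_unit tofrac1 hornerE. Qed.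

Lemma laurentX g n : laurent_at1 g 1 -> laurent_at1 (g ^+ n) 1.
Proof.
move=> g1; elim: n => [|n IHn]; first exact: laurent1.
by rewrite exprS; have := laurentM g1 IHn; rewrite mulr1.
Qed.

Lemma laurent_zpow k : laurent_at1 (zpow vK vK^-1 k) 1.
Proof. by case: k => n; apply: laurentX; [exact: laurent_v | exact: laurent_vi]. Qed.

Lemma laurent_sum (I : eqType) (U : seq I) (g : I -> K) (n : I -> int) :
  (forall w, w \in U -> laurent_at1 (g w) (n w)) ->
  laurent_at1 (\sum_(w <- U) g w) (\sum_(w <- U) n w).
Proof.
elim: U => [|u U IHU] H; first by rewrite !big_nil; exact: laurent0.
rewrite !big_cons; apply: laurentD; first by apply: H; rewrite mem_head.
by apply: IHU => w wU; apply: H; rewrite inE wU orbT.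
Qed.

(* Specializing at [v = 1] shows that every [p w] vanishes there; dividing all of them
   by [v - 1] and iterating, they are divisible by every power of [v - 1]. *)
Lemma independent_of_at1 (I : eqType) (U : seq I) (g : I -> I -> K) (p : I -> {poly int}) :
  uniq U ->
  {in U &, forall u w, laurent_at1 (g u w) (u == w)%:Z} ->
  {in U, forall u, \sum_(w <- U) tofrac (p w) * g u w = 0} ->
  {in U, forall w, p w = 0}.
Proof.
move=> uU Hg Hp.
have div1 q : {in U, forall u, \sum_(w <- U) tofrac (q w) * g u w = 0} ->
    exists r : I -> {poly int},
      {in U, forall w, q w = r w * ('X - 1%:P)} /\
      {in U, forall u, \sum_(w <- U) tofrac (r w) * g u w = 0}.
  move=> Hq; have H w : exists r, w \in U -> q w = r * ('X - 1%:P).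
    have [wU|_] := boolP (w \in U); last by exists 0.
    suff : root (q w) 1 by move/factor_theorem => [r ->]; exists r.
    have : laurent_at1 0 (\sum_(u <- U) (q u).[1] * (w == u)%:Z).
      rewrite -(Hq _ wU); apply: laurent_sum => u u1.
      by apply: laurentM; [exact: laurent_poly | exact: Hg].
    move/laurent_uniq0; rewrite (bigD1_seq w) //= eqxx mulr1 big1 ?addr0.
      by move=> e; rewrite /root e.
    by move=> u; rewrite eq_sym => /negbTE ->; rewrite mulr0.
  have [r Hr] := boolp.choice H; exists r; split=> [w|u uU']; first exact: Hr.
  have X1 : tofrac ('X - 1%:P : {poly int}) != 0 :> K.
    by rewrite tofrac_eq0 polyXsubC_eq0.
  apply: (mulfI X1); rewrite /= mulr0 mulr_sumr -[RHS](Hq _ uU') big_seq [RHS]big_seq.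
  by apply: eq_bigr => w /Hr ->; rewrite tofracM mulrA [tofrac (r w) * _]mulrC.
have divN n : forall q, {in U, forall u, \sum_(w <- U) tofrac (q w) * g u w = 0} ->
    {in U, forall w, exists r, q w = r * ('X - 1%:P) ^+ n}.
  elim: n => [|n IHn] q Hq w wU; first by exists (q w); rewrite expr0 mulr1.
  have [r [rq Hr]] := div1 _ Hq; have [s sr] := IHn _ Hr w wU.
  by exists s; rewrite rq // sr exprSr mulrA.
(* A nonzero [p w] has degree below [size (p w)], so that power of [v - 1] cannot divide it. *)
move=> w wU; apply/eqP; apply: contraT => p0.
have [r pr] := divN (size (p w)) p Hp w wU.
have r0 : r != 0 by apply: contraNneq p0 => r0; rewrite pr r0 mul0r.
have := congr1 (fun q : {poly int} => size q) pr.
rewrite /= size_mul ?size_exp_XsubC //; last first.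
  by rewrite expf_neq0 // polyXsubC_eq0.
by rewrite addnS /= => /eqP; rewrite -[X in X == _]add0n eqn_add2r eq_sym size_poly_eq0 (negbTE r0).
Qed.

Variables (S : eqType) (M : coxmat S) (L : S -> int).

Lemma laurent_hecke_act x (F : seq S -> K) (G : seq S -> int) :
  (forall w, laurent_at1 (F w) (G w)) ->
  forall w, laurent_at1 (hecke_act M L vK vK^-1 x F w) (hecke_act M L 1 1 x G w).
Proof.
have zp1 k : zpow 1 1 k = 1 :> int by case: k => n; rewrite /= expr1n.
elim: x F G => [|||||x IHx y IHy|x IHx|x IHx y IHy] /= => [||||s|||] F G FG w.
- exact: laurent0.
- exact: FG.
- by apply: laurentM => //; exact: laurent_v.
- by apply: laurentM => //; exact: laurent_vi.
- apply: laurentD; first exact: FG.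
  case: ifP => _; last exact: laurent0.
  apply: laurentM => //; rewrite /hecke_param !zp1.
  by apply: laurentD; [|apply: laurentN]; exact: laurent_zpow.
- by apply: laurentD; [exact: IHx | exact: IHy].
- by apply: laurentN; exact: IHx.
- by apply: IHx; exact: IHy.
Qed.

Variables (sp sm : S).
Local Notation S' := (contr_type sp sm).

(** At [v = 1] all parameters vanish: generators act by right translation, and [T_sp^-1] acts as
    [T_sp]. *)
Lemma hecke_act_phi_at1 (u : seq S') (F : seq S -> int) w :
  hecke_act M L 1 1 (phi_v L (tprod (map (@TGen S') u))) F w = F (w ++ contr_word u).
Proof.
have zp1 k : zpow 1 1 k = 1 :> int by case: k => n; rewrite /= expr1n.
have gen s G x : right_mul M L 1 1 s G x = G (x ++ [:: s]) :> int.
  by rewrite /right_mul /hecke_param !zp1 subrr mul0r; case: ifP; rewrite addr0.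
elim: u w => [|x u IHu] w; first by rewrite cats0.
case: x => [a|]; rewrite /= !gen ?hecke_act_vpow ?IHu -?catA //=.
by rewrite !zp1 subrr subr0.
Qed.

End Laurent.

(** * Evaluation of integer polynomials in a ring *)

Section PolyEval.
Local Open Scope ring_scope.
Variables (A : pzRingType) (t : A).

Definition int_poly_eval (p : {poly int}) : A := \sum_(i < size p) t ^+ i *~ p`_i.

Lemma int_poly_evalE n (p : {poly int}) : (size p <= n)%N ->
  int_poly_eval p = \sum_(i < n) t ^+ i *~ p`_i.
Proof.
move=> pn; rewrite /int_poly_eval (big_ord_widen _ (fun i => t ^+ i *~ p`_i) pn).
rewrite big_mkcond; apply: eq_bigr => i _; case: ltnP => // ip.
by rewrite nth_default // mulr0z.
Qed.

Lemma int_poly_evalD : {morph int_poly_eval : p q / p + q}.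
Proof.
move=> p q; pose n := maxn (size p) (size q).
rewrite !(@int_poly_evalE n) ?leq_maxl ?leq_maxr ?size_polyD // -big_split.
by apply: eq_bigr => i _; rewrite coefD mulrzDr.
Qed.

Lemma int_poly_eval0 : int_poly_eval 0 = 0.
Proof. by rewrite /int_poly_eval size_poly0 big_ord0. Qed.

Lemma int_poly_eval_monomial (b : bool) n :
  int_poly_eval ((-1) ^+ b * 'X^n) = (-1) ^+ b * t ^+ n.
Proof.
have -> : (-1) ^+ b * 'X^n = ((-1) ^+ b)%:P * 'X^n :> {poly int}.
  by case: b; rewrite ?expr1 ?expr0 ?polyCN.
rewrite (@int_poly_evalE n.+1); last first.
  by rewrite mul_polyC; apply: leq_trans (size_scale_leq _ _) _; rewrite size_polyXn.
rewrite (bigD1 ord_max) //= big1 ?addr0 => [|i ni].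
  rewrite coefCM coefXn eqxx mulr1.
  by case: b; rewrite ?expr1 ?expr0 ?mulN1r ?mul1r // mulrNz.
by rewrite coefCM coefXn (negbTE (_ : (i : nat) != n)) ?mulr0 ?mulr0z.
Qed.

End PolyEval.

(** * Injectivity *)

Section Injectivity.
Local Open Scope ring_scope.
Import fraction.
Variables (S : eqType) (M : coxmat S) (L : S -> int) (sp sm : S).
Hypotheses (HM : is_coxeter_matrix M) (HL : is_weight M L).
Hypotheses (spm : sp != sm) (M3 : M sp sm = Some 3%N).
Local Notation S' := (contr_type sp sm).
Local Notation N := (contr_mat M sp sm).
Local Notation L' := (contr_weight L sp sm).
Local Notation K := {fraction {poly int}}.
Local Notation actK := (hecke_act M L vK vK^-1).
Local Notation vH' := (vz (hecke_rel N L')).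

Let delta (A : nzRingType) (u w : seq S) : A := (`[< cox_eq M u w >])%:R.

Let delta_class u : class_fun M (delta K u).
Proof.
move=> w w' ww'; rewrite /delta; congr (nat_of_bool _)%:R.
by apply/asboolP/asboolP => uw; apply: cox_trans uw _; [|exact: cox_sym].
Qed.

(** Evaluating at the empty word the action on an element of the dual basis reads off a coefficient:
    here that of the basis element of [contr_word u] in [phi_v (T'_w)]. *)
Let coef (u w : seq S') : K :=
  actK (phi_v L (tprod (map (@TGen S') w))) (delta K (contr_word u)) [::].

Let coef_at1 u w : canonical_word N u = u -> canonical_word N w = w ->
  laurent_at1 (coef u w) (u == w)%:Z.
Proof.
move=> cu cw.
have -> : (u == w)%:Z = hecke_act M L 1 1 (phi_v L (tprod (map (@TGen S') w)))
    (delta int (contr_word u)) [::].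
  rewrite hecke_act_phi_at1 /delta cat0s natz; congr (Posz (nat_of_bool _)).
  apply/eqP/asboolP => [->|/(contr_word_inj HM spm M3)]; first exact: cox_refl.
  by move/canonical_word_eq; rewrite cu cw.
apply: laurent_hecke_act => x; rewrite /delta; case: asboolP => _.
  exact: laurent1.
exact: laurent0.
Qed.

Let actK_comb l F w : actK (phi_v L (comb_term l)) F w =
  \sum_(k <- l) (-1) ^+ k.1.1 *
     (zpow vK vK^-1 k.1.2 * actK (phi_v L (tprod (map (@TGen S') k.2))) F w).
Proof.
elim: l => [|[[b j] u] l IHl]; first by rewrite big_nil.
rewrite big_cons -IHl /= /monomial_term /=.
by case: b; rewrite /= phi_vpow hecke_act_vpow ?expr1 ?expr0 ?mulN1r ?mul1r.
Qed.

Let zpow_shift n j : (`|j| <= n)%N ->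
  vK ^+ n * zpow vK vK^-1 j = tofrac ('X^(absz (j + n%:Z))) :> K.
Proof.
rewrite tofracXn -/vK; case: j => m /= mn.
  by rewrite -exprD; congr (_ ^+ _); lia.
rewrite NegzE in mn *; have -> : absz (- m.+1%:Z + n%:Z) = (n - m.+1)%N by lia.
by rewrite -{1}(@subnK m.+1 n) 1?exprD; [rewrite -mulrA -exprMn vK_unit expr1n mulr1 | lia].
Qed.

Theorem phi_injective0 x :
  hecke_eq M L (phi_v L x) T0 -> hecke_eq N L' x T0.
Proof.
move=> phix; have HN := contr_coxeter sp sm HM; have HcN := contr_formP sp sm HM.
have [l lcan xl] := hecke_spanned L' HN HcN x.
have canl w : w \in undup (map snd l) -> canonical_word N w = w.
  rewrite mem_undup => /mapP [k kl ->]; exact/eqP/(allP lcan).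
(* Multiplication by [v^n] makes all coefficients polynomials; [p w] below is [v^n] times the
   coefficient of [T'_w]. *)
pose n := \max_(k <- l) `|k.1.2|%N.
have nl k : k \in l -> (`|k.1.2| <= n)%N.
  by move=> kl; rewrite /n (big_rem k) //= leq_maxl.
pose p w : {poly int} := \sum_(k <- l | k.2 == w) (-1) ^+ k.1.1 * 'X^(absz (k.1.2 + n%:Z)).
have relK F : class_fun M F ->
    \sum_(k <- l) (-1) ^+ k.1.1 * (zpow vK vK^-1 k.1.2 *
       actK (phi_v L (tprod (map (@TGen S') k.2))) F [::]) = 0 :> K.
  move=> HF; rewrite -actK_comb.
  have e : hecke_eq N L' x (comb_term l) by apply/clsP; rewrite xl cls_comb_term.
  have := phi_well_defined HL spm M3 (ae_sym e).
  move=> /ae_trans /(_ phix).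
  by move=> /(hecke_act_sound HM (standard_formP HM) HL vK_unit) /(_ F HF) ->.
have p0 : {in undup (map snd l), forall w, p w = 0}.
  apply: (independent_of_at1 (g := coef)) => [|u w uU wU|u uU].
  - exact: undup_uniq.
  - by apply: coef_at1; exact: canl.
  have := congr1 ( *%R (vK ^+ n)) (relK _ (delta_class (contr_word u))).
  rewrite mulr0; apply: etrans; rewrite mulr_sumr [RHS](big_group_undup _ snd).
  apply: eq_bigr => w _; rewrite /p rmorph_sum mulr_suml big_seq_cond [RHS]big_seq_cond.
  apply: eq_bigr => k /andP[kl /eqP kw].
  by rewrite /= rmorphM rmorph_sign /= -zpow_shift ?nl // -kw /coef; ring.
(* [v^n] is invertible in [H_{S/e}], so it suffices that [v^n x] vanishes; grouped by words, its
   coefficients are the values of the [p w] at [v]. *)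
apply/clsP; have vzK : vH' (- n%:Z) * vH' n = 1 by rewrite -vzD addNr.
rewrite -[cls _ x]mul1r -vzK -mulrA cls0 xl.
suff -> : vH' n * (\sum_(k <- l) monomial_val N L' k) = 0 by rewrite mulr0.
rewrite mulr_sumr (big_group_undup _ snd) big_seq big1 // => w wU.
transitivity (int_poly_eval (cls (hecke_rel N L') TV) (p w) * \prod_(s <- w) gen N L' s);
  last by rewrite p0 // int_poly_eval0 mul0r.
rewrite /p (big_morph _ (int_poly_evalD _) (int_poly_eval0 _)) mulr_suml.
rewrite [LHS]big_seq_cond [RHS]big_seq_cond; apply: eq_bigr => k /andP[kl /eqP kw].
rewrite int_poly_eval_monomial -vzX /monomial_val kw mulrA (vz_central _ (_ ^+ _)).
have -> : (absz (k.1.2 + n%:Z) : int) = n%:Z + k.1.2 by have := nl _ kl; lia.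
by rewrite vzD -!mulrA.
Qed.

End Injectivity.

Theorem mainTheorem6 (S : eqType) (M : coxmat S) (L : S -> int) (sp sm : S) :
  is_coxeter_matrix M -> is_weight M L -> sp != sm -> M sp sm = Some 3%N ->
  forall x y : term (contr_type sp sm),
    hecke_eq M L (phi_v L x) (phi_v L y) ->
    hecke_eq (contr_mat M sp sm) (contr_weight L sp sm) x y.
Proof.
move=> HM HL spm M3 x y xy.
have /clsP : hecke_eq (contr_mat M sp sm) (contr_weight L sp sm) (TSub x y) T0.
  apply: (phi_injective0 HM HL spm M3); apply/clsP; move/clsP: xy => xy.
  by rewrite /= clsB xy cls0 subrr.
by rewrite clsB cls0 => /eqP; rewrite subr_eq0 => /eqP/clsP.
Qed.
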